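(* There exists a linear-time (i.e., $O(|V|+|E|)$) algorithm that decides, for a given weighted graph $(G=(V,E),\omega)$, whether it is level-chain, i.e., whether all its level graphs are chain graphs.
   Context: A weighted graph is a pair $(G,\omega)$ with $G$ finite simple undirected and $\omega:E(G)\to\{1,\dots,k\}$ surjective for some $k\ge1$. For $1\le i\le k+1$ the $i$-th level graph is obtained from $G$ by removing all edges $e$ with $\omega(e)<i$. A chain graph is a bipartite graph whose vertex set can be partitioned into two independent sets $X,Y$ such that the neighborhoods of the vertices of $X$ are linearly ordered by inclusion. *)

(* Defs.v *)
From mathcomp Require Import all_boot all_order.
Set Implicit Arguments. Unset Strict Implicit. Unset Printing Implicit Defensive.

(* Weighted graphs, given concretely as an edge list on vertices       *)
(* 0..n-1.  An entry ((u, v), w) is the undirected edge {u,v} of       *)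
(* weight w.                                                            *)

Definition wedge := (nat * nat * nat)%type.
Definition esrc (e : wedge) : nat := e.1.1.
Definition edst (e : wedge) : nat := e.1.2.
Definition ewt  (e : wedge) : nat := e.2.

(* unordered endpoint pair, used to forbid parallel edges *)
Definition ekey (e : wedge) : nat * nat :=
  (minn (esrc e) (edst e), maxn (esrc e) (edst e)).

Definition maxw (es : seq wedge) : nat := \max_(e <- es) ewt e.

(* (G, omega) is a weighted graph: G finite simple undirected on
   {0..n-1}, omega : E -> {1..k} surjective for some k >= 1
   (necessarily k = maxw es). *)
Definition valid_wgraph (n : nat) (es : seq wedge) : Prop :=
  [/\ es != [::],
      all (fun e => [&& esrc e < n, edst e < n, esrc e != edst e & 0 < ewt e]) es,
      uniq (map ekey es) &
      forall j, 0 < j <= maxw es -> has (fun e => ewt e == j) es].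

Definition level_adj (n : nat) (es : seq wedge) (i : nat) : rel 'I_n :=
  fun x y => has (fun e => (i <= ewt e) &&
     (((esrc e == x) && (edst e == y)) || ((esrc e == y) && (edst e == x)))) es.

Arguments level_adj : clear implicits.
Definition chain_graph (n : nat) (g : rel 'I_n) : Prop :=
  exists X : {set 'I_n},
    [/\ (forall x y, x \in X -> y \in X -> ~~ g x y),
        (forall x y, x \notin X -> y \notin X -> ~~ g x y) &
        (forall x y, x \in X -> y \in X ->
           {subset g x <= g y} \/ {subset g y <= g x})].

Definition level_chain (n : nat) (es : seq wedge) : Prop :=
  forall i, 1 <= i <= (maxw es).+1 -> @chain_graph n (level_adj n es i).

(* Model of computation: a word RAM.  Unit-cost instructions on        *)
(* registers and memory cells holding natural numbers; to model the    *)
(* O(log n)-bit word size, the statement bounds every value ever       *)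
(* written (tracked in [peak]) linearly in the input size.             *)

Inductive instr : Type :=
| IConst of nat & nat
| IAdd of nat & nat & nat
| ISub of nat & nat & nat
| ILoad of nat & nat
| IStore of nat & nat
| IJz of nat & nat
| IHalt.

Definition program := seq instr.

Record state := State {
  pc : nat; regs : nat -> nat; mem : nat -> nat; peak : nat }.

Definition upd (f : nat -> nat) (a v : nat) : nat -> nat :=
  fun x => if x == a then v else f x.

Definition setreg (s : state) (r v : nat) : state :=
  State (pc s).+1 (upd (regs s) r v) (mem s) (maxn (peak s) v).

(* one step; out-of-range program counter behaves as IHalt *)
Definition step (P : program) (s : state) : state :=
  match nth IHalt P (pc s) with
  | IConst r c => setreg s r c
  | IAdd r a b => setreg s r (regs s a + regs s b)
  | ISub r a b => setreg s r (regs s a - regs s b)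
  | ILoad r a => setreg s r (mem s (regs s a))
  | IStore a b => State (pc s).+1 (regs s) (upd (mem s) (regs s a) (regs s b))
                        (maxn (peak s) (regs s b))
  | IJz r l => State (if regs s r == 0 then l else (pc s).+1) (regs s) (mem s) (peak s)
  | IHalt => s
  end.

Definition halted (P : program) (s : state) : bool :=
  if nth IHalt P (pc s) is IHalt then true else false.

Definition exec (P : program) (t : nat) (s : state) : state := iter t (step P) s.

(* input encoding: M[0] = n, M[1] = m = |E|, then the m triples
   (u_i, v_i, w_i) at addresses 2+3i, 3+3i, 4+3i; all other cells 0 *)
Definition encode (n : nat) (es : seq wedge) : seq nat :=
  n :: size es :: flatten [seq [:: esrc e; edst e; ewt e] | e <- es].

Definition init_state (input : seq nat) : state :=
  State 0 (fun _ => 0) (fun a => nth 0 input a) 0.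

(* Main.v *)
Require Import Defs.
From mathcomp Require Import all_boot all_order zify.
Set Implicit Arguments. Unset Strict Implicit. Unset Printing Implicit Defensive.

(* In a chain graph a vertex of maximum degree (the hub) is adjacent to every
   non-isolated vertex of the other side.  Hence the neighborhood of the hub of G
   is one side of a bipartition which, if it works for G at all, serves all level
   graphs.  Relative to a bipartition, being a chain graph is a numerical
   condition: the partition of left degrees is conjugate to the partition of right
   degrees.  Inserting one edge changes a single entry of each of the degree
   sequence, its conjugate and its double conjugate, so inserting the edges by
   decreasing weight maintains the l1-distance between the two partitions in
   constant time per edge; every level graph is a chain graph iff this distance is
   zero after each weight class.  Bucketing the edges by weight is linear because
   surjectivity of the weights bounds them by |E|.  The algorithm is written in a
   small while-language whose operations increase the largest stored value by at
   most one, so that its compilation to the RAM inherits a bound on the word size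
   from the bound on the running time. *)

(** * A while-language and its compilation to the RAM *)

Notation memory := Defs.mem.

Inductive op : Type :=
| OZero of nat
| OMov of nat & nat
| OSucc of nat & nat
| OPred of nat & nat
| OSub of nat & nat & nat
| ODiff of nat & nat & nat
| OGet of nat & nat & nat
| OPut of nat & nat & nat
| OIn of nat & nat & nat.

Inductive cmd : Type :=
| Op of op
| Skip
| Seq of cmd & cmd
| If of nat & cmd & cmd
| While of nat & cmd.

Record store := Store { vv : nat -> nat; av : nat -> nat -> nat }.

Definition edge_nth (es : seq wedge) i := nth (0, 0, 0) es i.

Definition field (e : wedge) k := nth 0 [:: esrc e; edst e; ewt e] k.

Definition setv s r x := Store (upd (vv s) r x) (av s).

Definition seta s a i x :=
  Store (vv s) (fun b => if b == a then upd (av s a) i x else av s b).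

Definition opsem es (o : op) (s : store) : store :=
  match o with
  | OZero r => setv s r 0
  | OMov r a => setv s r (vv s a)
  | OSucc r a => setv s r (vv s a).+1
  | OPred r a => setv s r (vv s a).-1
  | OSub r a b => setv s r (vv s a - vv s b)
  | ODiff r a b => setv s r ((vv s a - vv s b) + (vv s b - vv s a))
  | OGet r a i => setv s r (av s a (vv s i))
  | OPut a i r => seta s a (vv s i) (vv s r)
  | OIn r k i => setv s r (field (edge_nth es (vv s i)) k)
  end.

(** Sixteen arrays are interleaved, so their cells are disjoint only for names below 16; an input
    read past the last triple would hit array storage. *)
Definition opok (es : seq wedge) (o : op) (s : store) : bool :=
  match o with
  | OGet _ a _ | OPut a _ _ => a < 16
  | OIn _ k i => (k < 3) && (vv s i < size es)
  | _ => true
  end.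

Inductive ev es : cmd -> store -> nat -> store -> Prop :=
| EvOp o s : opok es o s -> ev es (Op o) s 1 (opsem es o s)
| EvSkip s : ev es Skip s 0 s
| EvSeq c1 c2 s t1 s1 t2 s2 :
    ev es c1 s t1 s1 -> ev es c2 s1 t2 s2 -> ev es (Seq c1 c2) s (t1 + t2) s2
| EvThen r c1 c2 s t s1 :
    vv s r != 0 -> ev es c1 s t s1 -> ev es (If r c1 c2) s t.+1 s1
| EvElse r c1 c2 s t s1 :
    vv s r = 0 -> ev es c2 s t s1 -> ev es (If r c1 c2) s t.+1 s1
| EvDone r c s : vv s r = 0 -> ev es (While r c) s 1 s
| EvLoop r c s t1 s1 t2 s2 :
    vv s r != 0 -> ev es c s t1 s1 -> ev es (While r c) s1 t2 s2 ->
    ev es (While r c) s (t1 + t2).+1 s2.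

(* Even registers hold the variables; odd ones are private to the compiler. *)
Definition vreg r := r.*2.
Definition sreg k := k.*2.+1.
Notation rzero := (sreg 0).
Notation rbase := (sreg 1).
Notation rtmp := (sreg 2).
Notation raux := (sreg 3).

Definition base (es : seq wedge) := 2 + 3 * size es.

(* Cell [i] of array [a] is stored at [base + 16 * i + a]. *)
Definition comp_addr a i : seq instr :=
  [:: IAdd rtmp (vreg i) (vreg i); IAdd rtmp rtmp rtmp; IAdd rtmp rtmp rtmp;
      IAdd rtmp rtmp rtmp; IAdd rtmp rtmp rbase; IConst raux a;
      IAdd rtmp rtmp raux].

Definition comp_op (o : op) : seq instr :=
  match o with
  | OZero r => [:: IConst (vreg r) 0]
  | OMov r a => [:: IAdd (vreg r) (vreg a) rzero]
  | OSucc r a => [:: IConst raux 1; IAdd (vreg r) (vreg a) raux]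
  | OPred r a => [:: IConst raux 1; ISub (vreg r) (vreg a) raux]
  | OSub r a b => [:: ISub (vreg r) (vreg a) (vreg b)]
  | ODiff r a b => [:: ISub rtmp (vreg a) (vreg b); ISub raux (vreg b) (vreg a);
                       IAdd (vreg r) rtmp raux]
  | OGet r a i => comp_addr a i ++ [:: ILoad (vreg r) rtmp]
  | OPut a i r => comp_addr a i ++ [:: IStore rtmp (vreg r)]
  | OIn r k i => [:: IAdd rtmp (vreg i) (vreg i); IAdd rtmp rtmp (vreg i);
                     IConst raux (2 + k); IAdd rtmp rtmp raux;
                     ILoad (vreg r) rtmp]
  end.

Fixpoint csize (c : cmd) : nat :=
  match c with
  | Op o => size (comp_op o)
  | Skip => 0
  | Seq c1 c2 => csize c1 + csize c2
  | If _ c1 c2 => (csize c1 + csize c2).+2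
  | While _ c => (csize c).+2
  end.

(** Jump targets are absolute, hence the start address [p] and the separate length function [csize].
    The register [rzero] is never written, so [IJz rzero] is an unconditional jump. *)
Fixpoint comp (c : cmd) (p : nat) : seq instr :=
  match c with
  | Op o => comp_op o
  | Skip => [::]
  | Seq c1 c2 => comp c1 p ++ comp c2 (p + csize c1)
  | If r c1 c2 =>
      IJz (vreg r) (p + (csize c1).+2) ::
      comp c1 p.+1 ++ IJz rzero (p + csize c) :: comp c2 (p + (csize c1).+2)
  | While r c1 =>
      IJz (vreg r) (p + csize c) :: comp c1 p.+1 ++ [:: IJz rzero p]
  end.

Lemma size_comp c p : size (comp c p) = csize c.
Proof.
elim: c p => [o||c1 IH1 c2 IH2|r c1 IH1 c2 IH2|r c IH] p //=.
- by rewrite size_cat IH1 IH2.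
- by rewrite size_cat /= IH1 IH2 addnS.
- by rewrite size_cat /= IH addn1.
Qed.

(** * Correctness of the compiler *)

Definition code_at (P : program) p (l : seq instr) : Prop :=
  forall k, k < size l -> nth IHalt P (p + k) = nth IHalt l k.

Lemma code_at_cat P p l1 l2 :
  code_at P p (l1 ++ l2) -> code_at P p l1 /\ code_at P (p + size l1) l2.
Proof.
move=> H; split=> k kl.
- by rewrite H ?size_cat ?ltn_addr // nth_cat kl.
- by rewrite -addnA H ?size_cat ?ltn_add2l // nth_cat ltnNge leq_addr addKn.
Qed.

Lemma code_at_cons P p i l :
  code_at P p (i :: l) -> nth IHalt P p = i /\ code_at P p.+1 l.
Proof.
move=> H; split; first by have := H 0 isT; rewrite addn0.
by move=> k kl; rewrite addSnnS (H k.+1).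
Qed.

Definition straight (i : instr) : bool :=
  match i with IJz _ _ | IHalt => false | _ => true end.

Definition istep (S : state) (i : instr) : state :=
  match i with
  | IConst r c => setreg S r c
  | IAdd r a b => setreg S r (regs S a + regs S b)
  | ISub r a b => setreg S r (regs S a - regs S b)
  | ILoad r a => setreg S r (memory S (regs S a))
  | IStore a b => State (pc S).+1 (regs S) (upd (memory S) (regs S a) (regs S b))
                        (maxn (peak S) (regs S b))
  | _ => S
  end.

Lemma exec_add P t1 t2 S : exec P (t1 + t2) S = exec P t2 (exec P t1 S).
Proof. by rewrite /exec addnC iterD. Qed.

Lemma exec_straight P l S : all straight l -> code_at P (pc S) l ->
  exec P (size l) S = foldl istep S l /\ pc (foldl istep S l) = pc S + size l.
Proof.
elim: l S => [|i l IH] S; first by rewrite addn0.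
case/andP=> si sl /code_at_cons[hi hl].
have E : step P S = istep S i by rewrite /step hi; case: i si {hi}.
have pcE : pc (istep S i) = (pc S).+1 by case: i si {hi E}.
rewrite [size (_ :: _)]/= -add1n exec_add /= E; have [|-> ->] := IH (istep S i) sl.
  by rewrite pcE.
by rewrite pcE addSnnS.
Qed.

Lemma upd_eq f a v : upd f a v a = v.
Proof. by rewrite /upd eqxx. Qed.

Lemma vreg_sreg r k : (vreg r == sreg k) = false.
Proof. by apply/eqP; rewrite /vreg /sreg; lia. Qed.

Lemma sreg_vreg r k : (sreg k == vreg r) = false.
Proof. by rewrite eq_sym vreg_sreg. Qed.

Lemma upd_sv f r k v : upd f (sreg k) v (vreg r) = f (vreg r).
Proof. by rewrite /upd vreg_sreg. Qed.

Lemma upd_vs f r k v : upd f (vreg r) v (sreg k) = f (sreg k).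
Proof. by rewrite /upd sreg_vreg. Qed.

Lemma upd_ss f k l v : upd f (sreg k) v (sreg l) = if l == k then v else f (sreg l).
Proof. by rewrite /upd /sreg eqSS (inj_eq double_inj). Qed.

Lemma upd_vvr f k l v : upd f (vreg k) v (vreg l) = if l == k then v else f (vreg l).
Proof. by rewrite /upd /vreg (inj_eq double_inj). Qed.

Definition updE := (upd_eq, upd_sv, upd_vs, upd_ss, upd_vvr).

(* [B] bounds every value of the store.  An operation raises it by at most one,
   so a bound on the running time is also a bound on the word size. *)
Record simul (es : seq wedge) (B : nat) (s : store) (S : state) : Prop := Simul {
  sim_v : forall r, regs S (vreg r) = vv s r;
  sim_a : forall a i, a < 16 -> memory S (base es + 16 * i + a) = av s a i;
  sim_in : forall k i, k < 3 -> i < size es ->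
             memory S (2 + 3 * i + k) = field (edge_nth es i) k;
  sim_zero : regs S rzero = 0;
  sim_base : regs S rbase = base es;
  sim_vB : forall r, vv s r <= B;
  sim_aB : forall a i, av s a i <= B;
  sim_eB : forall k i, field (edge_nth es i) k <= B;
  sim_pk : peak S <= base es + 16 * B + 16 }.

Lemma addr_inj e a b i j : a < 16 -> b < 16 ->
  (e + 16 * i + a == e + 16 * j + b) = (a == b) && (i == j).
Proof. by move=> *; apply/eqP/andP=> [h|[/eqP-> /eqP->] //]; split; lia. Qed.

Lemma simul_set es B s S S' r x :
  simul es B s S -> x <= B.+1 ->
  (forall q, regs S' (vreg q) = if q == r then x else regs S (vreg q)) ->
  memory S' = memory S -> regs S' rzero = 0 -> regs S' rbase = base es ->
  peak S' <= base es + 16 * B.+1 + 16 ->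
  simul es B.+1 (setv s r x) S'.
Proof.
case=> hv ha hi hz hb bv ba be bp xB hR hM hz' hb' bp'.
split=> //=; rewrite ?hM //; try by move=> *; apply: leqW.
- by move=> q; rewrite hR hv.
- by move=> q; rewrite /upd; case: ifP => // _; apply: leqW.
Qed.

(** The largest intermediate value is an array address, which is below [base es + 16 * B + 16]; this
    dictates the form of the bound on [peak]. *)
Lemma simul_op es B o s S : simul es B s S -> opok es o s ->
  simul es B.+1 (opsem es o s) (foldl istep S (comp_op o)).
Proof.
move=> H; case: (H); case: S H => p R M K H /= hv ha hi hz hb bv ba be bp.
have bvS r : vv s r <= B.+1 by apply: leqW.
have set1 r x S' : x <= B.+1 ->
    (forall q, regs S' (vreg q) = if q == r then x else R (vreg q)) ->
    [/\ memory S' = M, regs S' rzero = 0, regs S' rbase = base es &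
      peak S' <= base es + 16 * B.+1 + 16] ->
    simul es B.+1 (setv s r x) S'.
  by move=> xB hR []; apply: simul_set H _ _.
case: o => [r|r a|r a|r a|r a b|r a b|r a i|a i r|r k i] /= ok;
  rewrite /setreg /= ?updE /= ?updE /= ?updE /= ?hz ?hb ?hv.
- apply: set1 => //=; first by move=> q; rewrite !updE.
  by rewrite !updE hz hb; split=> //; lia.
- apply: set1 => //=; first by move=> q; rewrite !updE addn0.
  by rewrite !updE hz hb; have := bv a; split=> //; lia.
- apply: set1 => //=; first by rewrite ltnS.
    by move=> q; rewrite !updE addn1.
  by rewrite !updE hz hb; have := bv a; split=> //; lia.
- have := bv a => ?; apply: set1 => //=; first by lia.
    by move=> q; rewrite !updE subn1.
  by rewrite !updE hz hb; split=> //; lia.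
- have := bv a => ?; apply: set1 => //=; first by lia.
    by move=> q; rewrite !updE.
  by rewrite !updE hz hb; split=> //; lia.
- have := bv a; have := bv b => ? ?; apply: set1 => //=; first by lia.
    by move=> q; rewrite !updE.
  by rewrite !updE hz hb; split=> //; lia.
- have := bv i => ?.
  have -> : vv s i + vv s i + (vv s i + vv s i) = 4 * vv s i by lia.
  have -> : 4 * vv s i + 4 * vv s i + (4 * vv s i + 4 * vv s i) + base es + a
    = base es + 16 * vv s i + a by lia.
  rewrite ha //; apply: set1 => //=; first exact: leqW.
    by move=> q; rewrite !updE.
  by rewrite !updE hz hb; have := ba a (vv s i); split=> //; lia.
- have := bv i => ?; have := bv r => ?.
  have -> : vv s i + vv s i + (vv s i + vv s i) = 4 * vv s i by lia.
  have -> : 4 * vv s i + 4 * vv s i + (4 * vv s i + 4 * vv s i) + base es + a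
    = base es + 16 * vv s i + a by lia.
  split=> //=; rewrite ?updE //=; try by move=> *; apply: leqW.
  + by move=> q; rewrite !updE hv.
  + move=> b j hb'; rewrite /upd addr_inj //.
    by case: (b =P a) => [->|_] /=; rewrite ?ha //; case: eqP => // _; rewrite ha.
  (* Arrays start at [base es], past the last triple, so the input survives the write. *)
  + move=> k j hk hj; rewrite /upd ifF ?hi //; apply/eqP; rewrite /base; lia.
  + move=> b j; case: eqP => _; last exact: leqW.
    by rewrite /upd; case: ifP => _; apply: leqW.
  + by lia.
- case/andP: ok => hk hlt; have := bv i => ?.
  have -> : vv s i + vv s i + vv s i + k.+2 = 2 + 3 * vv s i + k by lia.
  rewrite hi //; apply: set1 => //=; first exact: leqW.
    by move=> q; rewrite !updE.
  by rewrite !updE hz hb; have := be k (vv s i); move: bp; rewrite /base; split=> //; lia.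
Qed.

Lemma straight_op o : all straight (comp_op o).
Proof. by case: o. Qed.

Lemma size_op o : size (comp_op o) <= 8.
Proof. by case: o. Qed.

(** [simul] says nothing about the program counter, so this covers every jump. *)
Lemma simul_weaken es B B' s S p : B <= B' -> simul es B s S ->
  simul es B' s (State p (regs S) (memory S) (peak S)).
Proof.
move=> le [hv ha hi hz hb bv ba be bp]; split=> //=.
- by move=> r; apply: leq_trans le.
- by move=> a i; apply: leq_trans le.
- by move=> k i; apply: leq_trans le.
- by lia.
Qed.

(** Induction is on the derivation, since each turn of a loop runs the same code again. The factor 8
    is the length of the longest block of an operation; a test and its closing jump take at most two
    steps for one unit of source time. *)
Lemma compP es P c s t s' : ev es c s t s' ->
  forall p B S, code_at P p (comp c p) -> pc S = p -> simul es B s S ->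
  exists t', let S' := exec P t' S in
    [/\ t' <= 8 * t, pc S' = p + csize c & simul es (B + t) s' S'].
Proof.
elim=> {c s t s'}.
- move=> o s ok p B S cP pS H; exists (size (comp_op o)).
  have [|E pE] := exec_straight (P := P) (S := S) (straight_op o).
    by rewrite pS.
  split; rewrite ?E ?pE ?pS //; first by rewrite muln1 size_op.
  by rewrite addn1; apply: simul_op.
- move=> s p B S _ pS H; exists 0; split=> //=; first by rewrite addn0.
  by rewrite addn0.
- move=> c1 c2 s t1 s1 t2 s2 _ IH1 _ IH2 p B S /= /code_at_cat[].
  rewrite size_comp => cP1 cP2 pS H.
  have [t1' [le1 p1 H1]] := IH1 p B S cP1 pS H.
  have [t2' [le2 p2 H2]] := IH2 _ _ _ cP2 p1 H1.
  by exists (t1' + t2'); rewrite exec_add; split; rewrite ?p2 ?addnA //; lia.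
- move=> r c1 c2 s t s1 rn _ IH p B S /= /code_at_cons[h0].
  case/code_at_cat=> cP1; rewrite size_comp => /code_at_cons[h1 _] pS H.
  have E : exec P 1 S = State p.+1 (regs S) (memory S) (peak S).
    by rewrite /exec /= /step pS h0 (sim_v H) (negbTE rn).
  have := IH p.+1 B (exec P 1 S) cP1; rewrite E => /(_ erefl).
  case=> [|t' [le' p' H']]; first exact: simul_weaken H.
  exists (1 + t' + 1); rewrite !exec_add E.
  set S1 := exec P t' _ in p' H' *.
  have -> : exec P 1 S1 =
      State (p + (csize c1 + csize c2).+2) (regs S1) (memory S1) (peak S1).
    by rewrite /exec /= /step p' h1 (sim_zero H').
  by split=> //=; [lia | apply: simul_weaken H'; lia].
- move=> r c1 c2 s t s1 rn _ IH p B S /= /code_at_cons[h0].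
  case/code_at_cat=> cP1; rewrite size_comp => /code_at_cons[h1].
  have -> : (p.+1 + csize c1).+1 = p + (csize c1).+2 by lia.
  move=> cP2 pS H.
  have E : exec P 1 S = State (p + (csize c1).+2) (regs S) (memory S) (peak S).
    by rewrite /exec /= /step pS h0 (sim_v H) rn.
  have := IH _ B (exec P 1 S) cP2; rewrite E => /(_ erefl).
  case=> [|t' [le' p' H']]; first exact: simul_weaken H.
  exists (1 + t'); rewrite !exec_add E; split; rewrite ?p'; [lia|lia|].
  rewrite addnS; case: (exec P t' _) H' => pp R M K H'.
  exact: simul_weaken (leqnSn _) H'.
- move=> r c s r0 p B S /= /code_at_cons[h0 _] pS H.
  have E : exec P 1 S = State (p + (csize c).+2) (regs S) (memory S) (peak S).
    by rewrite /exec /= /step pS h0 (sim_v H) r0.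
  by exists 1; rewrite E; split=> //; apply: simul_weaken H; lia.
- move=> r c s t1 s1 t2 s2 rn _ IH1 _ IH2 p B S /= cP.
  have := cP => /code_at_cons[h0 /code_at_cat[cP1]].
  rewrite size_comp => /code_at_cons[h1 _] pS H.
  have E : exec P 1 S = State p.+1 (regs S) (memory S) (peak S).
    by rewrite /exec /= /step pS h0 (sim_v H) (negbTE rn).
  have := IH1 p.+1 B (exec P 1 S) cP1; rewrite E => /(_ erefl).
  case=> [|t' [le' p' H']]; first exact: simul_weaken H.
  set S1 := exec P t' _ in p' H'.
  have E1 : exec P 1 S1 = State p (regs S1) (memory S1) (peak S1).
    by rewrite /exec /= /step p' h1 (sim_zero H').
  have := IH2 p (B + t1).+1 (exec P 1 S1) cP; rewrite E1 => /(_ erefl).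
  case=> [|t'' [le'' p'' H'']]; first exact: simul_weaken H'.
  exists (1 + t' + 1 + t''); rewrite !exec_add E E1.
  split=> //; first by lia.
  have -> : B + (t1 + t2).+1 = (B + t1).+1 + t2 by lia.
  by [].
Qed.

(** * Loading the input and running a compiled program *)

Definition prologue : seq instr :=
  [:: IConst raux 1; ILoad (vreg 1) raux; IAdd rbase (vreg 1) (vreg 1);
      IAdd rbase rbase (vreg 1); IConst raux 2; IAdd rbase rbase raux].

Definition full_prog c : program := prologue ++ comp c 6.

Definition store0 (es : seq wedge) :=
  Store (fun r => if r == 1 then size es else 0) (fun _ _ => 0).

Lemma nth_encode n es i k : i < size es -> k < 3 ->
  nth 0 (encode n es) (2 + 3 * i + k) = field (edge_nth es i) k.
Proof.
move=> + k3; rewrite /encode -addnA /= !add0n {n}.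
elim: es i => [|e es IH] [|i] // hi.
  by rewrite muln0 add0n; case: k k3 {IH} => [|[|[]]].
by rewrite mulnS -addnA -[RHS]IH.
Qed.

Lemma nth_encode_out n es p : base es <= p -> nth 0 (encode n es) p = 0.
Proof.
move=> h; apply: nth_default; apply: leq_trans h.
rewrite /encode /base /= size_flatten /shape -map_comp.
elim: es => //= e es; rewrite /sumn /=; lia.
Qed.

(** The six instructions of the prologue put |E| into variable 1 and [base es] into [rbase]. The
    initial value bound [B] is [n + size es]; zero memory beyond the input represents the empty
    arrays of [store0]. *)
Lemma full_progP n es c t s' : all (fun e => [&& esrc e <= n + size es,
    edst e <= n + size es & ewt e <= n + size es]) es ->
  ev es c (store0 es) t s' ->
  exists t', let S := exec (full_prog c) t' (init_state (encode n es)) in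
   [/\ t' <= 6 + 8 * t, halted (full_prog c) S,
      peak S <= base es + 16 * (n + size es + t) + 16 & regs S 0 = vv s' 0].
Proof.
move=> bnd H; pose P := full_prog c.
have [cP0 cP1] : code_at P 0 prologue /\ code_at P 6 (comp c 6).
  by apply: (@code_at_cat P 0).
have [E pE] := exec_straight (P := P) (l := prologue)
   (S := init_state (encode n es)) isT cP0.
set S0 := foldl _ _ _ in E pE.
have H0 : simul es (n + size es) (store0 es) S0.
  rewrite /S0 /= /setreg /= ?updE /= ?updE /=; split=> //=.
  - by move=> r; rewrite !updE.
  - move=> a i a16. apply: (@nth_encode_out n es (base es + 16 * i + a)).
    by rewrite -addnA leq_addr.
  - by move=> k i k3 hi; apply: (@nth_encode n es i k).
  - by rewrite !updE /base; lia.
  - by move=> r; case: ifP; lia.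
  - move=> k i; case: (ltnP i (size es)) => hi; last first.
      by rewrite /edge_nth nth_default // /field; case: k => [|[|[|[|?]]]].
    have /allP/(_ _ (mem_nth (0,0,0) hi))/and3P[h1 h2 h3] := bnd.
    by rewrite /field; case: k => [|[|[|[|?]]]].
  - by rewrite /base; lia.
have [t' [le' p' H']] := compP H cP1 pE H0.
exists (6 + t'); rewrite exec_add E; split.
- by lia.
(* The program counter has run past the end, where the default instruction is [IHalt]. *)
- by rewrite /halted p' nth_default // size_cat size_comp.
- exact: sim_pk H'.
- exact: (sim_v H' 0).
Qed.

(** * Chain graphs and conjugate degree sequences *)

Section Ferrers.
Variable T : finType.
Implicit Types g : rel T.

Definition outdeg g x := #|[set y | g x y]|.
Definition indeg g y := #|[set x | g x y]|.
Definition out_gt g j := #|[set x | j < outdeg g x]|.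
Definition in_gt g i := #|[set y | i < indeg g y]|.

(** Read as a bipartite graph with rows and columns as sides, [g] has no induced matching of two
    edges; equivalently, its rows are nested. *)
Definition two_k2_free g :=
  forall x y x' y', g x y -> g x' y' -> g x y' || g x' y.

(** The rows of degree above [j] are nested, so a smallest one lies inside all the others: each of
    its more than [j] columns meets at least [out_gt g j] rows. *)
Lemma two_k2_free_in_gt g i j : two_k2_free g -> i < out_gt g j -> j < in_gt g i.
Proof.
move=> free; rewrite {1}/out_gt; set A := [set x | _] => iA.
have [x0 x0A] : exists x, x \in A by apply/card_gt0P; apply: leq_trans iA.
case: (arg_minnP (outdeg g) x0A) => x xA xmin.
have : j < outdeg g x by have : x \in A := xA; rewrite inE.
move/leq_trans; apply; apply/subset_leq_card/subsetP => y; rewrite !inE => gxy.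
apply: (leq_trans iA); apply/subset_leq_card/subsetP => x' x'A; rewrite inE.
apply: contraT => ngx'y; have /subset_leqif_cards[_] : [set y | g x' y] \subset [set y | g x y].
  apply/subsetP=> y'; rewrite !inE => gx'y'.
  by have := free _ _ _ _ gxy gx'y'; rewrite (negbTE ngx'y) orbF.
have /eqP -> : #|[set y | g x' y]| == #|[set y | g x y]|.
  rewrite eqn_leq (xmin _ x'A) andbT; apply/subset_leq_card/subsetP => y'.
  rewrite !inE => gx'y'.
  by have := free _ _ _ _ gxy gx'y'; rewrite (negbTE ngx'y) orbF.
by rewrite eqxx => /esym/eqP/setP/(_ y); rewrite !inE gxy (negbTE ngx'y).
Qed.

(* The row of largest degree must contain every non-empty column; removing it
   lowers all non-empty columns by one and preserves the hypothesis. *)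
Lemma gt_two_k2_free g :
  (forall i j, (i < out_gt g j) = (j < in_gt g i)) -> two_k2_free g.
Proof.
have [k] := ubnP #|[set x | 0 < outdeg g x]|.
elim: k g => // k IH g; rewrite ltnS => le_k H.
case: (set_0Vmem [set x | 0 < outdeg g x]) => [E|[x0]].
  move=> x y x' y' gxy _; move/setP/(_ x): E; rewrite !inE.
  by case: posnP => // /eqP; rewrite cards_eq0 => /eqP/setP/(_ y); rewrite !inE gxy.
rewrite inE => x0gt.
have [x _ ge_x] := arg_maxnP (outdeg g) (erefl : predT x0).
have xmax u : outdeg g u <= outdeg g x by apply: ge_x.
have xgt : 0 < outdeg g x by apply: leq_trans x0gt (xmax _).
set d := outdeg g x in xmax xgt.
(* The hypothesis at [i = 0] makes the maximum row degree [d] equal to the number of non-empty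
   columns, and row [x] consists of such columns only. *)
have full y z : g z y -> g x y.
  move=> gzy; have : [set y | g x y] \subset [set y | 0 < indeg g y].
    apply/subsetP => y'; rewrite !inE => gxy'.
    by apply/card_gt0P; exists x; rewrite inE.
  move/subset_leqif_cards => [_ E].
  have : d == in_gt g 0.
    rewrite eqn_leq -{1}(prednK xgt) -H; apply/andP; split.
      by apply/card_gt0P; exists x; rewrite inE prednK.
    rewrite leqNgt -H -leqNgt leqn0 cards_eq0; apply/eqP/setP=> z'.
    by rewrite !inE ltnNge xmax.
  rewrite E => /eqP/setP/(_ y); rewrite !inE => ->.
  by apply/card_gt0P; exists z; rewrite inE.
pose g' u y := (u != x) && g u y.
have od u : outdeg g' u = if u == x then 0 else outdeg g u.
  rewrite /outdeg /g'; case: eqP => _ /=; last by [].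
  by apply/eqP; rewrite cards_eq0; apply/eqP/setP=> y; rewrite !inE.
(* By [full], a column missed by [x] is empty, and there the predecessor of 0 is 0. *)
have idg y : indeg g' y = (indeg g y).-1.
  rewrite /indeg; case gxy: (g x y).
    rewrite [in RHS](cardsD1 x) inE gxy /=; apply: eq_card => u.
    by rewrite !inE.
  have E : [set u | g u y] = set0.
    by apply/setP=> u; rewrite !inE; apply/negP => /full; rewrite gxy.
  rewrite E cards0; apply/eqP; rewrite cards_eq0; apply/eqP/setP=> u.
  by rewrite !inE /g'; move/setP/(_ u): E; rewrite !inE => ->; rewrite andbF.
have free' : two_k2_free g'.
  apply: IH => [|i j].
    apply: leq_trans le_k; rewrite [leqRHS](cardsD1 x) inE xgt ltnS.
    apply/subset_leq_card/subsetP=> u; rewrite !inE od.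
    by case: eqP.
  have -> : in_gt g' i = in_gt g i.+1.
    by apply: eq_card => y; rewrite !inE idg ltn_predRL.
  rewrite -H [in RHS]/out_gt (cardsD1 x) inE -/d.
  have -> : #|[set x | j < outdeg g x] :\ x| = out_gt g' j.
    by apply: eq_card => u; rewrite !inE od; case: eqP.
  (* For [j < d] the row [x] was counted and both sides drop by one; for [d <= j] no row was counted
     at all. *)
  case: (ltnP j d) => dj; rewrite ?add1n ?add0n //.
  have -> : out_gt g' j = 0.
    apply/eqP; rewrite cards_eq0; apply/eqP/setP=> u; rewrite !inE od.
    by case: eqP => // _; apply/negbTE; rewrite -leqNgt; apply: leq_trans (xmax _) dj.
  by [].
move=> u y u' y' guy gu'y'.
have [->|ux] := eqVneq u x; first by rewrite (full _ _ gu'y').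
have [->|u'x] := eqVneq u' x; first by rewrite (full _ _ guy) orbT.
by have := free' u y u' y'; rewrite /g' ux u'x /=; apply.
Qed.

End Ferrers.

Lemma two_k2_free_rev (T : finType) (g : rel T) :
  two_k2_free g -> two_k2_free (fun x y => g y x).
Proof. by move=> free x y x' y' h h'; rewrite orbC (free _ _ _ _ h h'). Qed.

(** A relation is a Ferrers diagram, up to permuting rows and columns, exactly when its row and
    column degrees are conjugate. Reversing the relation exchanges [out_gt] and [in_gt]. *)
Lemma two_k2_freeP (T : finType) (g : rel T) :
  two_k2_free g <-> (forall i j, (i < out_gt g j) = (j < in_gt g i)).
Proof.
split=> [free i j|]; last exact: gt_two_k2_free.
apply/idP/idP; first exact: two_k2_free_in_gt.
exact: (two_k2_free_in_gt (two_k2_free_rev free)).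
Qed.

(** * Conjugate sequences and their distance under unit increments *)

Definition conj N (f : nat -> nat) j := \sum_(i < N) (j < f i).

Definition dist N (f g : nat -> nat) := \sum_(j < N) ((f j - g j) + (g j - f j)).

Definition incr (f : nat -> nat) d := upd f d (f d).+1.

Lemma eq_conj N f g : f =1 g -> conj N f =1 conj N g.
Proof. by move=> fg j; apply: eq_bigr => i _; rewrite fg. Qed.

Lemma conj_le N f j : conj N f j <= N.
Proof.
rewrite -[leqRHS]card_ord -sum1_card; apply: leq_sum => i _.
by case: (_ < _).
Qed.

Lemma conj_mono N f i j : i <= j -> conj N f j <= conj N f i.
Proof.
move=> ij; apply: leq_sum => k _; case: ltnP => // jf.
by rewrite (leq_ltn_trans ij jf).
Qed.

Lemma conj_out N f j : (forall i, f i <= j) -> conj N f j = 0.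
Proof. by move=> fj; apply: big1 => i _; rewrite ltnNge fj. Qed.

(** Raising an entry from [f d] to its successor affects only the comparison with the threshold
    [f d]. *)
Lemma conj_incr N f d : d < N -> conj N (incr f d) =1 incr (conj N f) (f d).
Proof.
move=> dN j; rewrite /conj (bigD1 (Ordinal dN)) //= /incr /upd eqxx.
have -> : \sum_(i < N | i != Ordinal dN) (j < (if i == d :> nat then (f d).+1 else f i))
   = \sum_(i < N | i != Ordinal dN) (j < f i).
  by apply: eq_bigr => i; rewrite -val_eqE /= => /negbTE->.
case: eqP => [->|jfd]; rewrite [in RHS](bigD1 (Ordinal dN)) //=.
  by rewrite ltnSn ltnn.
by congr (_ + _); congr nat_of_bool; apply/idP/idP; lia.
Qed.

(** After one more increment this value would still be a count of indices below [N]. The bound keeps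
    the position touched in the double conjugate within range. *)
Lemma conj_lt N f d : d < N -> conj N f (f d) < N.
Proof.
move=> dN; have := conj_le N (incr f d) (f d).
by rewrite conj_incr // /incr upd_eq.
Qed.

(** For a nonincreasing [f] the indices whose value exceeds [j] form an initial segment, and
    [conj N f j] is its length cut off at [N]. *)
Lemma conj_gt N f i j : i < N -> (forall a b, a <= b -> f b <= f a) ->
  (i < conj N f j) = (j < f i).
Proof.
move=> iN fm; case: (ltnP j (f i)) => [jf|fj]; apply/idP.
  have <- : \sum_(k < i.+1) 1 = i.+1 by rewrite sum1_card card_ord.
  rewrite (big_ord_widen N (fun=> 1) iN) big_mkcond /=; apply: leq_sum => k _.
  by case: ltnP => // ki; rewrite (leq_trans jf) // fm.
apply/negP; rewrite -leqNgt.
have <- : \sum_(k < i) 1 = i by rewrite sum1_card card_ord.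
rewrite (big_ord_widen N (fun=> 1) (ltnW iN)) [leqRHS]big_mkcond /=.
apply: leq_sum => k _.
case: (ltnP k i) => [_|ik]; first exact: leq_b1.
by rewrite leqn0 eqb0 -leqNgt (leq_trans _ fj) // fm.
Qed.

Lemma eq_dist N f f' g g' : f =1 f' -> g =1 g' -> dist N f g = dist N f' g'.
Proof. by move=> ff gg; apply: eq_bigr => i _; rewrite ff gg. Qed.

Lemma distC N f g : dist N f g = dist N g f.
Proof. by apply: eq_bigr => i _; rewrite addnC. Qed.

(** Only term [d] moves, by one: towards [g d] if [f d] lies below it, away from it otherwise. *)
Lemma dist_incr N f g d : d < N ->
  dist N (incr f d) g = if f d < g d then (dist N f g).-1 else (dist N f g).+1.
Proof.
move=> dN; rewrite /dist (bigD1 (Ordinal dN)) //= /incr /upd eqxx.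
have -> : \sum_(i < N | i != Ordinal dN)
     ((if i == d :> nat then (f d).+1 else f i) - g i
      + (g i - (if i == d :> nat then (f d).+1 else f i)))
   = \sum_(i < N | i != Ordinal dN) ((f i - g i) + (g i - f i)).
  by apply: eq_bigr => i; rewrite -val_eqE /= => /negbTE->.
rewrite [in RHS](bigD1 (Ordinal dN)) //=; move: (\sum_(i < N | _) _) => S.
by case: (ltnP (f d) (g d)); lia.
Qed.

Lemma dist_incr_r N f g d : d < N ->
  dist N f (incr g d) = if g d < f d then (dist N f g).-1 else (dist N f g).+1.
Proof. by move=> dN; rewrite !(distC N f) dist_incr. Qed.

Lemma dist_eq0 N f g : reflect (forall j, j < N -> f j = g j) (dist N f g == 0).
Proof.
rewrite sum_nat_eq0; apply: (iffP forallP) => [H j jN|H j]; last first.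
  by rewrite H // subnn.
by have := H (Ordinal jN); rewrite /=; lia.
Qed.

Definition fdeg (L : seq (nat * nat)) x := count (fun p => p.1 == x) L.
Definition sdeg (L : seq (nat * nat)) y := count (fun p => p.2 == y) L.

(* [conj (sdeg L)] counts the right vertices of degree above a given value, so
   conjugating once more lists the right degrees in decreasing order.  The graph
   is a chain graph iff these are conjugate to the left degrees. *)
Definition imbalance N L :=
  dist N (conj N (fdeg L)) (conj N (conj N (sdeg L))).

Definition chain_list (L : seq (nat * nat)) :=
  forall p q, p \in L -> q \in L -> ((p.1, q.2) \in L) || ((q.1, p.2) \in L).

Lemma outdeg_fdeg N L (x : 'I_N) : uniq L -> (forall p, p \in L -> p.2 < N) ->
  outdeg (fun x y : 'I_N => (val x, val y) \in L) x = fdeg L x.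
Proof.
move=> uL bL; rewrite /outdeg cardsE -sum1_card big_mkcond /=.
have -> : fdeg L x = \sum_(p <- L) (p.1 == x).
  by rewrite /fdeg -sum1_count [LHS]big_mkcond.
rewrite (eq_bigr (fun y : 'I_N => \sum_(p <- L) (p == (val x, val y)))).
  rewrite exchange_big /=; apply: eq_big_seq => p pL.
  rewrite (bigD1 (Ordinal (bL p pL))) //= big1 ?addn0 => [|i].
    by rewrite -pair_eqE /= eqxx andbT.
  rewrite -val_eqE /= => ne.
  by rewrite -pair_eqE /= (eq_sym p.2) (negbTE ne) andbF.
move=> y _; rewrite -[RHS]big_mkcond sum1_count; rewrite -/(count_mem _ L).
by rewrite (count_uniq_mem _ uL) -[y \in _]/((val x, val y) \in L); case: (_ \in L).
Qed.

Definition swap (p : nat * nat) := (p.2, p.1).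

Lemma indeg_sdeg N L (y : 'I_N) : uniq L -> (forall p, p \in L -> p.1 < N) ->
  indeg (fun x y : 'I_N => (val x, val y) \in L) y = sdeg L y.
Proof.
have swapK : involutive swap by case.
move=> uL bL.
have -> : sdeg L y = fdeg (map swap L) y by rewrite /fdeg count_map.
rewrite -outdeg_fdeg ?map_inj_uniq //; last 2 first.
- exact: inv_inj.
- by move=> p /mapP[q qL ->]; apply: bL.
apply: eq_card => x; rewrite !inE -[(val y, val x)]/(swap (val x, val y)).
by rewrite mem_map //; exact: inv_inj.
Qed.

(** By [conj_gt], comparing with the double conjugate of the right degrees amounts to the criterion
    [two_k2_freeP]. All conjugates vanish from [N] on, so the range of [dist] loses nothing. *)
Lemma imbalanceP N L : uniq L -> size L < N ->
  (forall p, p \in L -> (p.1 < N) && (p.2 < N)) ->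
  imbalance N L = 0 <-> chain_list L.
Proof.
move=> uL sL bL.
pose g := fun x y : 'I_N => (val x, val y) \in L.
have E : chain_list L <-> two_k2_free g.
  split=> [H x y x' y' h h'|H p q pL qL]; first exact: (H _ _ h h').
  have /andP[p1 p2] := bL _ pL; have /andP[q1 q2] := bL _ qL.
  apply: (H (Ordinal p1) (Ordinal p2) (Ordinal q1) (Ordinal q2));
    by rewrite /g /= -surjective_pairing.
have cX j : out_gt g j = conj N (fdeg L) j.
  rewrite /out_gt cardsE -sum1_card big_mkcond /=; apply: eq_bigr => x _.
  by rewrite unfold_in outdeg_fdeg // => p /bL/andP[].
have cY j : in_gt g j = conj N (sdeg L) j.
  rewrite /in_gt cardsE -sum1_card big_mkcond /=; apply: eq_bigr => x _.
  by rewrite unfold_in indeg_sdeg // => p /bL/andP[].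
have f0 j : N <= j -> conj N (fdeg L) j = 0.
  by move=> Nj; apply: conj_out => i; exact: leq_trans (count_size _ _) (leq_trans (ltnW sL) Nj).
have s0 j : N <= j -> conj N (sdeg L) j = 0.
  by move=> Nj; apply: conj_out => i; exact: leq_trans (count_size _ _) (leq_trans (ltnW sL) Nj).
have mono a b := @conj_mono N (sdeg L) a b.
apply: (iff_trans _ (iff_sym E)); apply: (iff_trans _ (iff_sym (two_k2_freeP g))).
split=> [/eqP/dist_eq0 H i j|H].
  rewrite cX cY; case: (ltnP i N) => [iN|Ni]; last first.
    by rewrite s0 // !ltnNge (leq_trans (conj_le _ _ _)).
  case: (ltnP j N) => [jN|Nj]; first by rewrite H // conj_gt.
  by rewrite f0 // !ltnNge (leq_trans (conj_le _ _ _)).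
apply/eqP/dist_eq0 => j jN; apply/eqP; rewrite eqn_leq.
(* Two numbers that exceed the same [i] are equal. *)
have K i : (i < conj N (fdeg L) j) = (i < conj N (conj N (sdeg L)) j).
  rewrite -cX H cY; case: (ltnP i N) => [iN|Ni]; first by rewrite [in RHS]conj_gt.
  by rewrite s0 // !ltnNge (leq_trans (conj_le _ _ _)).
by rewrite leqNgt K ltnn leqNgt -K ltnn.
Qed.

(** * The bipartition given by a vertex of maximum degree *)

Definition joins (e : wedge) u v :=
  ((esrc e == u) && (edst e == v)) || ((esrc e == v) && (edst e == u)).

Definition nbr (es : seq wedge) u v := has (fun e => joins e u v) es.

Definition incident v (e : wedge) := (esrc e == v) || (edst e == v).

Definition mdeg es v := count (incident v) es.

(** When exactly one endpoint is marked, it comes second: the marked vertices form the right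
    side. *)
Definition orient (M : nat -> bool) (e : wedge) :=
  if M (edst e) then (esrc e, edst e) else (edst e, esrc e).

Definition bip (M : nat -> bool) es := all (fun e => M (esrc e) != M (edst e)) es.

Definition lev M es w := [seq orient M e | e <- es & w <= ewt e].

Lemma joinsC e u v : joins e u v = joins e v u.
Proof. by rewrite /joins orbC. Qed.

Lemma level_adjE n es i (x y : 'I_n) :
  level_adj n es i x y = has (fun e => (i <= ewt e) && joins e x y) es.
Proof. by []. Qed.

Lemma level_adjC n es i : symmetric (level_adj n es i).
Proof. by move=> x y; rewrite !level_adjE; apply: eq_has => e; rewrite joinsC. Qed.

(** Stated without naming the sides: if [a] and [a'] lie on the same side, one of the first two
    alternatives holds, otherwise one of the last two. *)
Lemma chain_graph_cross n (g : rel 'I_n) a b a' b' : symmetric g ->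
  chain_graph g -> g a b -> g a' b' -> [|| g a b', g a' b, g a a' | g b b'].
Proof.
move=> gC [X [indX indY nest]] gab ga'b'.
have side x y : g x y -> (x \in X) = (y \notin X).
  move=> gxy; case xX: (x \in X); case yX: (y \in X) => //=.
    by rewrite (negbTE (indX _ _ xX yX)) in gxy.
  by rewrite (negbTE (indY _ _ (negbT xX) (negbT yX))) in gxy.
have cross x y x' y' : x \in X -> x' \in X -> g x y -> g x' y' -> g x y' || g x' y.
  move=> xX x'X gxy gx'y'; case: (nest x x' xX x'X) => sub.
    by rewrite [g x' y](sub y gxy) orbT.
  by rewrite [g x y'](sub y' gx'y').
have := side _ _ gab; have := side _ _ ga'b'.
case aX: (a \in X); case a'X: (a' \in X) => /esym b'X /esym bX.
- by have := cross a b a' b' aX a'X gab ga'b'; do 2 case: (g _ _).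
- have := cross a b b' a' aX; rewrite (gC b') (gC b' b) => /(_ _ gab ga'b').
  by rewrite (negbFE b'X) => /(_ isT); case/orP=> ->; rewrite ?orbT.
- have := cross b a a' b'; rewrite (gC b) => /(_ _ a'X gab ga'b').
  by rewrite (negbFE bX) => /(_ isT); rewrite (gC a'); case/orP=> ->; rewrite ?orbT.
- have := cross b a b' a'; rewrite (gC b a) (gC b' a') => /(_ _ _ gab ga'b').
  by rewrite (negbFE bX) (negbFE b'X) (gC b a') (gC b' a) => /(_ isT isT); case/orP=> ->; rewrite ?orbT.
Qed.

Section Hub.
Variables (n : nat) (es : seq wedge) (hub : nat).
Hypothesis es_valid : valid_wgraph n es.
Hypothesis hub_max : forall v, mdeg es v <= mdeg es hub.

Local Notation M := (nbr es hub).

Lemma loopless e : e \in es ->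
  [&& esrc e < n, edst e < n, esrc e != edst e & 0 < ewt e].
Proof. by move=> ees; case: es_valid => _ /allP/(_ _ ees). Qed.

Lemma ewt_maxw e : e \in es -> ewt e <= maxw es.
Proof. by move=> ees; rewrite /maxw (big_rem e) //= leq_maxl. Qed.

(** The endpoint pair can be recovered from [f e], so the absence of parallel edges makes [f]
    injective on the list. *)
Lemma uniq_map_key (T : eqType) (f : wedge -> T) (h : T -> nat * nat) s :
  subseq s es -> {in s, forall e, ekey e = h (f e)} -> uniq (map f s).
Proof.
move=> sub hf; case: es_valid => _ _ u _; apply: (@map_uniq _ _ h).
have <- : map ekey s = map h (map f s) by rewrite -map_comp; apply/eq_in_map.
by apply: subseq_uniq u; apply: map_subseq.
Qed.

Lemma uniq_orient N s : subseq s es -> uniq (map (orient N) s).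
Proof.
move=> sub; apply: (uniq_map_key (h := fun p => (minn p.1 p.2, maxn p.1 p.2)) sub).
by move=> e _; rewrite /orient /ekey; case: ifP => //= _; rewrite minnC maxnC.
Qed.

Definition other v (e : wedge) := if esrc e == v then edst e else esrc e.
Definition nbrs v := [seq other v e | e <- es & incident v e].

Lemma mem_nbrs v b : (b \in nbrs v) = nbr es v b.
Proof.
apply/mapP/hasP => [[e]|[e ees]].
  rewrite mem_filter => /andP[inc ees] ->; exists e => //.
  move: inc; rewrite /incident /other /joins; case: eqP => [->|_] /=.
    by rewrite !eqxx.
  by move=> /eqP->; rewrite !eqxx.
move=> J; exists e; first rewrite mem_filter ees andbT.
  by move: J; rewrite /joins /incident; case/orP=> /andP[h1 h2]; rewrite ?h1 ?h2 ?orbT.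
move: J; rewrite /joins /other; case/orP=> /andP[/eqP<- /eqP<-].
  by rewrite eqxx.
by have /and4P[_ _ /negbTE-> _] := loopless ees.
Qed.

Lemma uniq_nbrs v : uniq (nbrs v).
Proof.
apply: (uniq_map_key (h := fun b => (minn v b, maxn v b))).
  exact: filter_subseq.
move=> e; rewrite mem_filter => /andP[+ _].
rewrite /incident /other /ekey; case: eqP => [->|_] //= /eqP->.
by rewrite minnC maxnC.
Qed.

(** Otherwise [x] would have all neighbors of the hub and [y] besides, exceeding the maximum
    degree. *)
Lemma hub_absorbs x y : (forall b, nbr es hub b -> nbr es x b) ->
  nbr es x y -> nbr es hub y.
Proof.
move=> sub xy; apply: contraT => nhy.
have : size (y :: nbrs hub) <= size (nbrs x).
  apply: uniq_leq_size; first by rewrite /= uniq_nbrs mem_nbrs nhy.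
  move=> b; rewrite inE !mem_nbrs => /orP[/eqP->//|]; exact: sub.
rewrite /= !size_map !size_filter -!/(mdeg es _).
by have := hub_max x; lia.
Qed.

Lemma hub_ord : {v : 'I_n | v = hub :> nat}.
Proof.
have : has (incident hub) es.
  case: es_valid => + _ _ _; case: {1 3 4 5}es hub_max (eqxx es) => // e s.
  move=> hm _ _; rewrite has_count -/(mdeg _ _) (leq_trans _ (hm (esrc e))) //.
  by rewrite /mdeg /= /incident eqxx.
move=> H; have hn : hub < n.
  case/hasP: H => e /loopless/and4P[sn dn _ _].
  by case/orP=> /eqP <-.
by exists (Ordinal hn).
Qed.

Lemma mem_lev w a b : bip M es ->
  ((a, b) \in lev M es w) =
  [&& ~~ M a, M b & has (fun e => (w <= ewt e) && joins e a b) es].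
Proof.
move=> B; apply/mapP/and3P => [[e]|[Ma Mb /hasP[e ees /andP[we J]]]].
  rewrite mem_filter => /andP[we ees] E.
  have := allP B _ ees; move: E; rewrite /orient; case: ifP => Md [-> ->] ne.
    split=> //; first by case: (M (esrc e)) ne.
    by apply/hasP; exists e; rewrite ?we // /joins !eqxx.
  rewrite Md; split=> //; first by case: (M (esrc e)) ne.
  by apply/hasP; exists e; rewrite ?we // /joins !eqxx orbT.
exists e; first by rewrite mem_filter we.
move: J; rewrite /orient /joins; case/orP=> /andP[/eqP-> /eqP->].
  by rewrite Mb.
by rewrite (negbTE Ma).
Qed.

Lemma level_chain_bip : level_chain n es -> bip M es.
Proof.
(* Weights are positive, so level 1 is the whole graph. *)
move=> /(_ 1) ch; have {ch} := ch isT; set g := level_adj n es 1 => ch.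
have gE x y : g x y = nbr es x y.
  rewrite /g level_adjE; apply: eq_in_has => e /loopless/and4P[_ _ _ w].
  by rewrite w.
have gC : symmetric g by apply: level_adjC.
have [v0 v0E] := hub_ord.
have [X [v0X indX indY]] : exists X : {set 'I_n}, [/\ v0 \in X,
    forall x y, x \in X -> y \in X -> ~~ g x y &
    forall x y, x \notin X -> y \notin X -> ~~ g x y].
  case: (ch) => X [iX iY _]; case v0X: (v0 \in X); first by exists X.
  exists (~: X); split=> [|x y|x y]; rewrite !inE ?v0X //; first exact: iY.
  by rewrite !negbK; apply: iX.
(* If the hub missed [y], crossing [x y] with each edge from the hub to some [b] would leave only
   the edge [x b]; then [x] has all neighbors of the hub and [hub_absorbs] applies. *)
have absorb x y : x \in X -> g x y -> M y.
  move=> xX gxy; apply: contraT => nMy.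
  rewrite -(negbTE nMy); apply: (@hub_absorbs x); last by rewrite -gE.
  move=> b hb; have [e ees J] := hasP hb.
  have bn : b < n.
    have /and4P[sn dn _ _] := loopless ees.
    by move: J; rewrite /joins; case/orP=> /andP[/eqP h1 /eqP h2]; rewrite -?h1 -?h2.
  have gv0b : g v0 (Ordinal bn) by rewrite gE v0E.
  have bX : Ordinal bn \notin X by apply: contraL gv0b; apply: indX.
  have yX : y \notin X by apply: contraL gxy; apply: indX.
  have := chain_graph_cross gC ch gv0b gxy.
  rewrite (negbTE (indX _ _ v0X xX)) (negbTE (indY _ _ bX yX)) !orbF.
  by rewrite !gE v0E (negbTE nMy).
apply/allP=> e ees; have /and4P[sn dn ne w] := loopless ees.
pose x := Ordinal sn; pose y := Ordinal dn.
have gxy : g x y by rewrite gE; apply/hasP; exists e; rewrite // /joins !eqxx.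
have MX z : z \in X -> ~~ M z by move=> zX; rewrite -v0E -gE indX.
case xX: (x \in X).
  by rewrite (negbTE (MX _ xX)) [M (edst e)](absorb x y).
case yX: (y \in X).
  by rewrite (negbTE (MX _ yX)) [M (esrc e)](absorb y x) // gC.
by rewrite (negbTE (indY _ _ (negbT xX) (negbT yX))) in gxy.
Qed.

(* The hub sees every non-isolated vertex of the other side, so its neighborhood
   is one side of the only possible bipartition. *)
Lemma level_chainP :
  level_chain n es <-> bip M es /\ forall w, 0 < w -> chain_list (lev M es w).
Proof.
split=> [H|[B H] i /andP[i0 _]].
  have B := level_chain_bip H; split=> // w w0 [a b] [a' b'] /= ab a'b'.
  (* The list for [w] contains an edge, so [w] is in the range covered by [level_chain]. *)
  have wk : 0 < w <= (maxw es).+1.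
    rewrite w0 /=; move: ab => /mapP[e]; rewrite mem_filter => /andP[we /ewt_maxw].
    by move=> h _; rewrite (leq_trans we) // leqW.
  have ch := H w wk; move: ab a'b'; rewrite !mem_lev //.
  move=> /and3P[nMa Mb jab] /and3P[nMa' Mb' jab'].
  have lt u v : has (fun e => (w <= ewt e) && joins e u v) es -> (u < n) && (v < n).
    case/hasP=> e /loopless/and4P[sn dn _ _] /andP[_]; rewrite /joins.
    by case/orP=> /andP[/eqP<- /eqP<-]; rewrite sn dn.
  have /andP[an bn] := lt _ _ jab; have /andP[an' bn'] := lt _ _ jab'.
  have same u v : M u = M v -> ~~ has (fun e => (w <= ewt e) && joins e u v) es.
    move=> E; apply/hasPn=> e /(allP B) ne; rewrite negb_and; apply/orP; right.
    apply: contra ne; rewrite /joins.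
    by case/orP=> /andP[/eqP-> /eqP->]; rewrite E.
  have := @chain_graph_cross n _ (Ordinal an) (Ordinal bn) (Ordinal an')
     (Ordinal bn') (@level_adjC n es w) ch jab jab'.
  rewrite !level_adjE /= (negbTE (same a a' _)) ?(negbTE (same b b' _)) ?orbF;
    by rewrite ?Mb ?Mb' ?(negbTE nMa) ?(negbTE nMa').
exists [set x : 'I_n | ~~ M x].
have arc (x y : 'I_n) : x \in [set x : 'I_n | ~~ M x] -> level_adj n es i x y ->
    (val x, val y) \in lev M es i.
  rewrite inE level_adjE mem_lev // => nMx J; rewrite nMx J andbT /=.
  case/hasP: J => e /(allP B) ne /andP[_]; rewrite /joins.
  by case/orP=> /andP[/eqP h1 /eqP h2]; move: ne; rewrite h1 h2 (negbTE nMx) //; case: (M y).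
split=> [x y|x y|x y xX yX].
- rewrite !inE => nMx nMy; apply/negP => gxy.
  have := arc x y; rewrite inE => /(_ nMx gxy); rewrite mem_lev //.
  by rewrite (negbTE nMy) andbF.
- rewrite !inE !negbK => Mx My; rewrite level_adjE; apply/hasPn => e /(allP B) ne.
  rewrite negb_and; apply/orP; right; apply: contra ne; rewrite /joins.
  by case/orP=> /andP[/eqP-> /eqP->]; rewrite Mx My.
(* If [x] has a neighbor [z] that [y] lacks, then [chain_list] on [(x, z)] and [(y, b)] forces the
   edge from [x] to [b], for every neighbor [b] of [y]. *)
case: (boolP [forall z, level_adj n es i x z ==> level_adj n es i y z]).
  by move/forallP=> h; left=> z; apply/implyP/h.
case/forallPn=> z; rewrite negb_imply => /andP[gxz ngyz]; right=> b gyb.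
have := H i i0 _ _ (arc _ _ xX gxz) (arc _ _ yX gyb).
rewrite /= !mem_lev // -!level_adjE (negbTE ngyz) !andbF orbF.
by case/and3P.
Qed.

End Hub.

(** * The program *)

Definition block (l : seq op) : cmd := foldr (fun o c => Seq (Op o) c) Skip l.

Arguments edge_nth es i : simpl never.

(** * Loop-free commands, frame rules and counting loops *)

Fixpoint run es (c : cmd) (s : store) : store :=
  match c with
  | Op o => opsem es o s
  | Seq c1 c2 => run es c2 (run es c1 s)
  | If r c1 c2 => if vv s r == 0 then run es c2 s else run es c1 s
  | Skip | While _ _ => s
  end.

(** [run] gives a loop the dummy meaning of doing nothing; rejecting loops here keeps [ev_run]
    sound. *)
Fixpoint safe es (c : cmd) (s : store) : bool :=
  match c with
  | Op o => opok es o s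
  | Skip => true
  | Seq c1 c2 => safe es c1 s && safe es c2 (run es c1 s)
  | If r c1 c2 => if vv s r == 0 then safe es c2 s else safe es c1 s
  | While _ _ => false
  end.

(** Charging both branches of a test yields a time bound independent of the store. *)
Fixpoint cost (c : cmd) : nat :=
  match c with
  | Op _ => 1
  | Seq c1 c2 => cost c1 + cost c2
  | If _ c1 c2 => (cost c1 + cost c2).+1
  | Skip | While _ _ => 0
  end.

Lemma run_seq es c1 c2 s : run es (Seq c1 c2) s = run es c2 (run es c1 s).
Proof. by []. Qed.

Lemma safe_seq es c1 c2 s :
  safe es c1 s -> safe es c2 (run es c1 s) -> safe es (Seq c1 c2) s.
Proof. by move=> /= -> ->. Qed.

Lemma ev_run es c s : safe es c s ->
  exists2 t, t <= cost c & ev es c s t (run es c s).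
Proof.
elim: c s => [o||c1 IH1 c2 IH2|r c1 IH1 c2 IH2|//] s /=.
- by move=> ok; exists 1 => //; apply: EvOp.
- by exists 0 => //; apply: EvSkip.
- case/andP=> /IH1[t1 le1 e1] /IH2[t2 le2 e2].
  by exists (t1 + t2); [apply: leq_add|apply: EvSeq e1 e2].
- case: eqP => [r0 /IH2|/eqP rn /IH1] [t le e]; exists t.+1; try by lia.
    exact: EvElse.
  exact: EvThen.
Qed.

Fixpoint wvars (c : cmd) : seq nat :=
  match c with
  | Op (OZero r | OMov r _ | OSucc r _ | OPred r _ | OSub r _ _
       | ODiff r _ _ | OGet r _ _ | OIn r _ _) => [:: r]
  | Op (OPut _ _ _) | Skip => [::]
  | Seq c1 c2 | If _ c1 c2 => wvars c1 ++ wvars c2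
  | While _ c => wvars c
  end.

Fixpoint warrs (c : cmd) : seq nat :=
  match c with
  | Op (OPut a _ _) => [:: a]
  | Op _ | Skip => [::]
  | Seq c1 c2 | If _ c1 c2 => warrs c1 ++ warrs c2
  | While _ c => warrs c
  end.

Lemma ev_frame_v es c s t s' r : ev es c s t s' -> r \notin wvars c ->
  vv s' r = vv s r.
Proof.
have U q x f : r \notin [:: q] -> upd f q x r = f r.
  by rewrite inE /upd => /negbTE->.
elim=> {c s t s'} //=.
- by move=> o s _; case: o => //= *; exact: U.
- by move=> c1 c2 s t1 s1 t2 s2 _ IH1 _ IH2; rewrite mem_cat negb_or => /andP[/IH1<- /IH2].
- by move=> q c1 c2 s t s1 _ _ IH; rewrite mem_cat negb_or => /andP[/IH].
- by move=> q c1 c2 s t s1 _ _ IH; rewrite mem_cat negb_or => /andP[_ /IH].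
- by move=> q c s t1 s1 t2 s2 _ _ IH1 _ IH2 h; rewrite IH2 // IH1.
Qed.

Lemma ev_frame_a es c s t s' a : ev es c s t s' -> a \notin warrs c ->
  av s' a = av s a.
Proof.
elim=> {c s t s'} //=.
- by move=> o s _; case: o => //= b i r; rewrite inE => /negbTE->.
- by move=> c1 c2 s t1 s1 t2 s2 _ IH1 _ IH2; rewrite mem_cat negb_or => /andP[/IH1<- /IH2].
- by move=> q c1 c2 s t s1 _ _ IH; rewrite mem_cat negb_or => /andP[/IH].
- by move=> q c1 c2 s t s1 _ _ IH; rewrite mem_cat negb_or => /andP[_ /IH].
- by move=> q c s t1 s1 t2 s2 _ _ IH1 _ IH2 h; rewrite IH2 // IH1.
Qed.

(** The register [i] is both loop test and downward counter, and the body itself decrements it. Each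
    turn pays one test, and the final [1] is the failing test. *)
Lemma ev_for es i body (C : nat -> nat) (I : nat -> store -> Prop) m s :
  (forall k s, k < m -> I k.+1 s -> vv s i = k.+1 ->
     exists t s', [/\ ev es body s t s', t <= C k, I k s' & vv s' i = k]) ->
  I m s -> vv s i = m ->
  exists t s', [/\ ev es (While i body) s t s',
    t <= \sum_(k < m) (C k).+1 + 1 & I 0 s'].
Proof.
elim: m s => [|m IH] s H Is si.
  exists 1, s; rewrite big_ord0; split=> //; exact: EvDone.
have [t1 [s1 [e1 le1 I1 s1i]]] := H m s (ltnSn m) Is si.
have [|t2 [s2 [e2 le2 I2]]] := IH s1 _ I1 s1i.
  by move=> k s0 km; apply: H; apply: leqW.
exists (t1 + t2).+1, s2; split=> //.
  by apply: EvLoop e1 e2; rewrite si.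
by rewrite big_ord_recr /=; move: (\sum_(k < m) _) le2 => S le2; lia.
Qed.

(** * Names of registers and arrays, and the code of the passes *)

Notation rOut := 0 (only parsing).
Notation rM := 1 (only parsing).
Notation rI := 2 (only parsing).
Notation rU := 3 (only parsing).
Notation rV := 4 (only parsing).
Notation rW := 5 (only parsing).
Notation rT := 6 (only parsing).
Notation rBest := 7 (only parsing).
Notation rHub := 8 (only parsing).
Notation rBad := 9 (only parsing).
Notation rP := 10 (only parsing).
Notation rX := 11 (only parsing).
Notation rY := 12 (only parsing).
Notation rD := 13 (only parsing).
Notation rImb := 14 (only parsing).
Notation rA := 15 (only parsing).
Notation rB := 16 (only parsing).
Notation aHead := 0 (only parsing).
Notation aNext := 1 (only parsing).
Notation aDeg := 2 (only parsing).
Notation aMark := 3 (only parsing).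
Notation aFdeg := 4 (only parsing).
Notation aFconj := 5 (only parsing).
Notation aSdeg := 6 (only parsing).
Notation aSconj := 7 (only parsing).
Notation aSsort := 8 (only parsing).

Definition set1 r := block [:: OZero r; OSucc r r].

Definition touch r := Seq
  (block [:: OGet rD aDeg r; OSucc rD rD; OPut aDeg r rD; OSub rT rD rBest])
  (If rT (block [:: OMov rBest rD; OMov rHub r]) Skip).

(** Pushes the edge onto the list of its weight. Links are stored as index plus one, so that
    zero-initialized memory means empty lists. *)
Definition scan_body :=
  Seq (block [:: OPred rI rI; OIn rU 0 rI; OIn rV 1 rI; OIn rW 2 rI;
    OGet rT aHead rW; OPut aNext rI rT; OSucc rT rI; OPut aHead rW rT])
  (Seq (touch rU) (touch rV)).

Definition mark_body :=
  Seq (block [:: OPred rI rI; OIn rU 0 rI; OIn rV 1 rI; OZero rD; OSucc rD rD;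
    ODiff rT rU rHub])
  (Seq (If rT Skip (block [:: OPut aMark rV rD]))
  (Seq (Op (ODiff rT rV rHub))
  (If rT Skip (block [:: OPut aMark rU rD])))).

Definition side_body :=
  Seq (block [:: OPred rI rI; OIn rU 0 rI; OIn rV 1 rI; OGet rA aMark rU;
    OGet rB aMark rV; ODiff rT rA rB])
  (If rT Skip (set1 rBad)).

(** Implements [dist_incr]: [r] holds an entry about to be incremented, [q] the entry of the other
    sequence at the same position. *)
Definition balance r q := Seq (Op (OSub rT q r))
  (If rT (Op (OPred rImb rImb)) (Op (OSucc rImb rImb))).

Definition pick_body := Seq
  (block [:: OPred rI rP; OIn rU 0 rI; OIn rV 1 rI; OGet rT aMark rV])
  (If rT (block [:: OMov rX rU; OMov rY rV]) (block [:: OMov rX rV; OMov rY rU])).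

Definition left_body := Seq
  (block [:: OGet rD aFdeg rX; OSucc rA rD; OPut aFdeg rX rA;
    OGet rA aFconj rD; OGet rB aSsort rD])
  (Seq (balance rA rB) (block [:: OSucc rA rA; OPut aFconj rD rA])).

(** Each update happens at the old value of the previous one: the degree of [rY] selects the entry
    of the conjugate, whose old value selects the entry of the double conjugate. *)
Definition right_body := Seq
  (block [:: OGet rD aSdeg rY; OSucc rA rD; OPut aSdeg rY rA;
    OGet rA aSconj rD; OSucc rB rA; OPut aSconj rD rB;
    OGet rB aSsort rA; OGet rD aFconj rA])
  (Seq (balance rB rD)
  (block [:: OSucc rB rB; OPut aSsort rA rB; OGet rP aNext rI])).

Definition insert_body := Seq pick_body (Seq left_body right_body).

Definition level_body :=
  Seq (Op (OGet rP aHead rW))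
  (Seq (While rP insert_body)
  (Seq (If rImb (set1 rBad) Skip)
  (Op (OPred rW rW)))).

Definition edge_pass body := Seq (Op (OMov rI rM)) (While rI body).

(** Starting at |E| avoids computing the maximum weight; a weight with an empty list costs only a
    constant. *)
Definition level_pass := Seq (Op (OMov rW rM)) (While rW level_body).

Definition answer := Seq (Op (OZero rOut)) (If rBad Skip (set1 rOut)).

Definition main : cmd :=
  Seq (edge_pass scan_body) (Seq (edge_pass mark_body)
  (Seq (edge_pass side_body) (Seq level_pass answer))).

(** * Correctness of the passes over the edges *)

Definition hub_inv (f : nat -> nat) (s : store) :=
  [/\ av s aDeg =1 f, forall v, f v <= vv s rBest & vv s rBest = f (vv s rHub)].

Lemma eq_hub_inv f g s : f =1 g -> hub_inv f s -> hub_inv g s.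
Proof.
move=> fg [df fle bE]; split=> [v|v|]; rewrite -?fg //; exact: df.
Qed.

(** [touch] overwrites [rD], [rT], [rBest] and [rHub], so the vertex has to sit in another
    register. *)
Lemma touch_hub es r f s : r \in [:: rU; rV] -> hub_inv f s ->
  hub_inv (incr f (vv s r)) (run es (touch r) s).
Proof.
rewrite !inE => rUV [df fle bE].
have dx : av s aDeg (vv s r) = f (vv s r) by [].
have main x s' : vv s rBest = f (vv s rHub) ->
    av s' aDeg = upd (av s aDeg) x (f x).+1 ->
    vv s' rBest = maxn (vv s rBest) (f x).+1 ->
    vv s' rHub = (if (f x).+1 - vv s rBest == 0 then vv s rHub else x) ->
    hub_inv (incr f x) s'.
  move=> _ aE b'E h'E; split=> [v|v|].
  - by rewrite aE /incr /upd; case: eqP => // _; apply: df.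
  - by rewrite b'E /incr /upd; have := fle v; case: eqP => [->|_]; lia.
  - rewrite b'E h'E /incr /upd; have := fle (vv s rHub); rewrite bE.
    case: (_ - _ =P 0) => h; last by rewrite eqxx; lia.
    by case: eqP => [E|_]; [rewrite E in h; lia|lia].
case/orP: rUV => /eqP E; rewrite {r}E in dx *; rewrite /touch /= /upd /= dx;
  apply: main => //; case: eqP => h //=; rewrite /upd /=; lia.
Qed.

Lemma safe_touch es r s : safe es (touch r) s.
Proof. by rewrite /touch /= if_same. Qed.

Lemma touch_frame es r s : let s' := run es (touch r) s in
  [/\ forall q, q \in [:: rI; rU; rV] -> vv s' q = vv s q,
      av s' aHead = av s aHead & av s' aNext = av s aNext].
Proof.
have [t _ e] := ev_run (safe_touch es r s).
split; try exact: ev_frame_a e _.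
move=> q; rewrite !inE => H; apply: ev_frame_v e _.
by case/or3P: H => /eqP->.
Qed.

Fixpoint linked (nx : nat -> nat) (l : seq nat) (p : nat) : Prop :=
  if l is i :: l' then p = i.+1 /\ linked nx l' (nx i) else p = 0.

Lemma eq_linked nx nx' l p : {in l, nx =1 nx'} -> linked nx l p -> linked nx' l p.
Proof.
elim: l p => //= i l IH p E [-> h]; split=> //.
rewrite -E ?mem_head //; apply: IH h => j jl; apply: E.
by rewrite inE jl orbT.
Qed.

(** Indices increase along the list because edges are scanned from last to first and pushed at the
    head. *)
Definition bucket es k w :=
  [seq j <- iota k (size es - k) | ewt (edge_nth es j) == w].

Lemma bucket_rec es k w : k < size es -> bucket es k w =
  (if ewt (edge_nth es k) == w then cons k else id) (bucket es k.+1 w).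
Proof.
move=> km; rewrite /bucket (_ : size es - k = (size es - k.+1).+1); last by lia.
by rewrite /=; case: eqP.
Qed.

Lemma drop_edge es k : k < size es -> drop k es = edge_nth es k :: drop k.+1 es.
Proof. by move=> km; rewrite (drop_nth (0, 0, 0)). Qed.

Definition scan_inv es k s :=
  hub_inv (mdeg (drop k es)) s /\
  forall w, linked (av s aNext) (bucket es k w) (av s aHead w).

(** A loop would be touched twice but counted once by [mdeg], hence the hypothesis. *)
Lemma scan_step es k s : all (fun e => esrc e != edst e) es -> k < size es ->
  scan_inv es k.+1 s -> vv s rI = k.+1 ->
  safe es scan_body s /\
  let s' := run es scan_body s in scan_inv es k s' /\ vv s' rI = k.
Proof.
move=> ll km [hI lk] si.
set e := edge_nth es k; have ne : esrc e != edst e.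
  by apply: (allP ll); apply: mem_nth.
split.
  apply: safe_seq; last by apply: safe_seq; apply: safe_touch.
  by rewrite /= /upd /= si /= km.
rewrite /scan_body; set blk := block _; cbv zeta.
pose s1 := run es blk s.
have h1 : hub_inv (mdeg (drop k.+1 es)) s1.
  by case: hI => d1 d2 d3; rewrite /s1 /blk /=; split; rewrite /= /upd.
have [[s1I s1U s1V] s1N s1H] :
  [/\ [/\ vv s1 rI = k, vv s1 rU = esrc e & vv s1 rV = edst e],
   av s1 aNext = upd (av s aNext) k (av s aHead (ewt e)) &
   av s1 aHead = upd (av s aHead) (ewt e) k.+1].
  by rewrite /s1 /blk /= /upd /= si /=.
rewrite run_seq -/s1 [run _ _ s1]run_seq.
have [fv fH fN] := touch_frame es rU s1.
pose s2 := run es (touch rU) s1; rewrite -/s2 in fv fH fN *.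
have [gv gH gN] := touch_frame es rV s2.
have h2 : hub_inv (incr (mdeg (drop k.+1 es)) (esrc e)) s2.
  by rewrite -s1U; apply: touch_hub.
have h3 : hub_inv (incr (incr (mdeg (drop k.+1 es)) (esrc e)) (edst e))
    (run es (touch rV) s2).
  by rewrite -s1V -[vv s1 rV]fv //; apply: touch_hub.
split; last by rewrite gv // fv.
split=> [|w].
  apply: eq_hub_inv h3 => v; rewrite (drop_edge km) -/e /mdeg /= /incident /incr /upd.
  rewrite ![v == _]eq_sym [edst e == esrc e]eq_sym (negbTE ne).
  case: (eqVneq (esrc e) v) => [<-|nv] /=; last by case: eqP => // ->.
  by rewrite eq_sym (negbTE ne).
rewrite gN gH fN fH s1N s1H bucket_rec // -/e.
(* Existing lists contain only indices above [k], so writing link [k] leaves them intact. *)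
have nx u : {in bucket es k.+1 w, av s aNext =1 upd (av s aNext) k u}.
  move=> j; rewrite mem_filter mem_iota => /andP[_ /andP[kj _]].
  by rewrite /upd gtn_eqF.
case: (eqVneq (ewt e) w) => [<-|nw] /=; last first.
  by rewrite [upd _ _ _ w]/upd [w == _]eq_sym (negbTE nw); apply: eq_linked (lk w); apply: nx.
rewrite upd_eq; split=> //; rewrite upd_eq; apply: eq_linked (lk _).
move=> j; rewrite mem_filter mem_iota => /andP[_ /andP[kj _]].
by rewrite /upd gtn_eqF.
Qed.

Definition mark_inv es hub k s :=
  (forall v, av s aMark v = nbr (drop k es) hub v) /\ vv s rHub = hub.

Lemma mark_step es hub k s : k < size es ->
  mark_inv es hub k.+1 s -> vv s rI = k.+1 ->
  safe es mark_body s /\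
  let s' := run es mark_body s in mark_inv es hub k s' /\ vv s' rI = k.
Proof.
move=> km [mk hE] si; split.
  by rewrite /mark_body /= /upd /= si /= km /= !if_same.
rewrite /mark_body; set blk := block _; cbv zeta.
set e := edge_nth es k; pose s1 := run es blk s.
rewrite run_seq -/s1.
have [s1I s1U s1V s1D] :
  [/\ vv s1 rI = k, vv s1 rU = esrc e, vv s1 rV = edst e & vv s1 rD = 1].
  by rewrite /s1 /blk /= /upd /= si /=.
have [s1T s1H s1M] : [/\ vv s1 rT = (esrc e - hub) + (hub - esrc e),
    vv s1 rHub = hub & av s1 aMark = av s aMark].
  by rewrite /s1 /blk /= /upd /= si /= hE.
move: s1 s1I s1U s1V s1D s1T s1H s1M => s1 s1I s1U s1V s1D s1T s1H s1M.
(* [ODiff] serves as an equality test. *)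
have tE a b : (a - b + (b - a) == 0) = (a == b) by apply/eqP/eqP; lia.
rewrite /= s1T tE; case: (eqVneq (esrc e) hub) => Eu /=;
  rewrite /upd /= s1V s1H tE s1U s1D; case: (eqVneq (edst e) hub) => Ev /=;
  (split; [split=> // v|by []]); rewrite (drop_edge km) -/e /= s1M ?s1V ?s1U ?s1D;
  rewrite /upd mk /joins ?Eu ?Ev ?eqxx ?(negbTE Eu) ?(negbTE Ev) /= ?orbF ?andbF ?andbT //=.
- by rewrite eq_sym; case: eqP.
- by rewrite eq_sym; case: eqP.
- by rewrite eq_sym; case: eqP.
Qed.

Definition side_inv es (M : nat -> bool) k s :=
  (forall v, av s aMark v = M v) /\ (vv s rBad == 0) = bip M (drop k es).

Lemma side_step es M k s : k < size es ->
  side_inv es M k.+1 s -> vv s rI = k.+1 ->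
  safe es side_body s /\
  let s' := run es side_body s in side_inv es M k s' /\ vv s' rI = k.
Proof.
move=> km [mk bE] si; split.
  by rewrite /side_body /= /upd /= si /= km /= !if_same.
rewrite /side_body /= /upd /= si /= /field /= !mk /side_inv (drop_edge km) /=.
by do 2 case: (M _); rewrite /= /upd /= ?si.
Qed.

(** * Correctness of the insertion of an edge *)

Definition list_inv N L s :=
  [/\ av s aFdeg =1 fdeg L, av s aFconj =1 conj N (fdeg L),
      av s aSdeg =1 sdeg L, av s aSconj =1 conj N (sdeg L) &
      av s aSsort =1 conj N (conj N (sdeg L))]
  /\ vv s rImb = imbalance N L.

Lemma run_balance es r q s : let d := vv s q - vv s r in
  run es (balance r q) s =
  setv (setv s rT d) rImb (if d == 0 then (vv s rImb).+1 else (vv s rImb).-1).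
Proof. by rewrite /= /upd /=; case: eqP. Qed.

Lemma safe_balance es r q s : safe es (balance r q) s.
Proof. by rewrite /= if_same. Qed.

Lemma fdeg_cons p L : fdeg (p :: L) =1 incr (fdeg L) p.1.
Proof.
by move=> x; rewrite /fdeg /= /incr /upd eq_sym; case: eqP => [->|_].
Qed.

Lemma sdeg_cons p L : sdeg (p :: L) =1 incr (sdeg L) p.2.
Proof.
by move=> x; rewrite /sdeg /= /incr /upd eq_sym; case: eqP => [->|_].
Qed.

(** The two sequences are incremented one after the other, as in the program: the second comparison,
    at position [r], already uses the updated [A']. *)
Lemma imbalance_cons N L p : p.1 < N -> p.2 < N -> size L < N ->
  let A := conj N (fdeg L) in let A' := incr A (fdeg L p.1) in
  let B := conj N (conj N (sdeg L)) in
  let d := fdeg L p.1 in let r := conj N (sdeg L) (sdeg L p.2) in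
  let D := if B d - A d == 0 then (imbalance N L).+1 else (imbalance N L).-1 in
  [/\ conj N (fdeg (p :: L)) =1 A',
      conj N (sdeg (p :: L)) =1 incr (conj N (sdeg L)) (sdeg L p.2),
      conj N (conj N (sdeg (p :: L))) =1 incr B r &
      imbalance N (p :: L) = if A' r - B r == 0 then D.+1 else D.-1].
Proof.
move=> p1 p2 sL A A' B d r D.
have cF : conj N (fdeg (p :: L)) =1 A'.
  by move=> j; rewrite (eq_conj N (fdeg_cons p L)) conj_incr.
have cS : conj N (sdeg (p :: L)) =1 incr (conj N (sdeg L)) (sdeg L p.2).
  by move=> j; rewrite (eq_conj N (sdeg_cons p L)) conj_incr.
have dN : fdeg L p.1 < N by apply: leq_ltn_trans (count_size _ _) sL.
have sN : sdeg L p.2 < N by apply: leq_ltn_trans (count_size _ _) sL.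
have cB : conj N (conj N (sdeg (p :: L))) =1 incr B r.
  by move=> j; rewrite (eq_conj N cS) conj_incr.
split=> //; rewrite /imbalance (eq_dist N cF cB) dist_incr_r ?conj_lt //.
rewrite dist_incr // -/(imbalance N L) -/A -/B -/d /D !subn_eq0.
by case: (ltnP (B r) (A' r)); case: (ltnP (A d) (B d)).
Qed.

Lemma pick_step es (M : nat -> bool) s i : i < size es -> vv s rP = i.+1 ->
  (forall v, av s aMark v = M v) -> let p := orient M (edge_nth es i) in
  safe es pick_body s /\ let s' := run es pick_body s in
  [/\ vv s' rX = p.1, vv s' rY = p.2, vv s' rI = i, vv s' rImb = vv s rImb &
      av s' = av s].
Proof.
move=> im pE mk p; split; first by rewrite /pick_body /= /upd /= pE /= im if_same.
rewrite /pick_body /= /upd /= pE /= /field /= mk /p /orient.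
by case: (M _).
Qed.

Lemma left_step es s : safe es left_body s /\ let s' := run es left_body s in
  let d := av s aFdeg (vv s rX) in
  [/\ vv s' rY = vv s rY, vv s' rI = vv s rI,
      vv s' rImb = (if av s aSsort d - av s aFconj d == 0 then (vv s rImb).+1
                    else (vv s rImb).-1) &
      forall a x, av s' a x =
        if a == aFconj then incr (av s aFconj) d x else
        if a == aFdeg then incr (av s aFdeg) (vv s rX) x else av s a x].
Proof.
split.
  by do 2 (apply: safe_seq => //); apply: safe_balance.
rewrite /left_body run_seq; set s1 := run _ _ s.
rewrite run_seq run_balance /= /upd /= /incr /upd.
by split=> // a x; case: eqP => // _; case: eqP.
Qed.

Lemma right_step es s : safe es right_body s /\ let s' := run es right_body s in
  let d := av s aSdeg (vv s rY) in let r := av s aSconj d in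
  [/\ vv s' rP = av s aNext (vv s rI),
      vv s' rImb = (if av s aFconj r - av s aSsort r == 0 then (vv s rImb).+1
                    else (vv s rImb).-1) &
      forall a x, av s' a x =
        if a == aSsort then incr (av s aSsort) r x else
        if a == aSconj then incr (av s aSconj) d x else
        if a == aSdeg then incr (av s aSdeg) (vv s rY) x else av s a x].
Proof.
split.
  by do 2 (apply: safe_seq => //); apply: safe_balance.
rewrite /right_body run_seq; set s1 := run _ _ s.
rewrite run_seq run_balance /= /upd /= /incr /upd.
by split=> // a x; case: eqP => // _; case: eqP => // _; case: eqP.
Qed.

Lemma insert_step es (M : nat -> bool) N L s i : i < size es -> vv s rP = i.+1 ->
  (forall v, av s aMark v = M v) -> list_inv N L s -> size L < N ->
  let p := orient M (edge_nth es i) in p.1 < N -> p.2 < N ->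
  safe es insert_body s /\
  let s' := run es insert_body s in
  list_inv N (p :: L) s' /\ vv s' rP = av s aNext i.
Proof.
move=> im pE mk [[fE cE gE hE kE] dE] sL p p1 p2.
have [sf1 [X Y I D A]] := pick_step im pE mk.
have [cF cS cB iE] := imbalance_cons p1 p2 sL.
rewrite /insert_body run_seq [run _ (Seq left_body _) _]run_seq.
have [sf2 H2] := left_step es (run es pick_body s).
have [sf3 H3] := right_step es (run es left_body (run es pick_body s)).
split; first by apply: safe_seq => //; apply: safe_seq.
(* Abstracting the intermediate stores keeps simplification from unfolding the program. *)
move: H3 H2 X Y I D A {sf1 sf2 sf3}; cbv zeta.
move: (run es pick_body s) => s2; move: (run es left_body s2) => s3.
move: (run es right_body s3) => s4.
case=> P4 D4 a4 [Y3 I3 D3 a3] X Y I D A.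
have d3 : av s2 aFdeg (vv s2 rX) = fdeg L p.1 by rewrite X A.
have d4 : av s3 aSdeg (vv s3 rY) = sdeg L p.2 by rewrite a3 /= Y3 Y A.
have r4 : av s3 aSconj (sdeg L p.2) = conj N (sdeg L) (sdeg L p.2).
  by rewrite a3 /= A.
have Q : incr (av s aFconj) (fdeg L p.1) =1 incr (conj N (fdeg L)) (fdeg L p.1).
  by move=> x; rewrite /incr /upd !cE.
rewrite d4 r4 in D4 a4; rewrite d3 in D3 a3.
split; last by rewrite P4 a3 /= A I3 I.
split.
  split=> x; rewrite ?fdeg_cons ?sdeg_cons a4 /= ?a3 /=.
  - by rewrite A X /incr /upd !fE.
  - by rewrite A Q cF.
  - by rewrite /incr /upd !a3 /= A Y3 Y !gE.
  - by rewrite cS /incr /upd !a3 /= A !hE.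
  - by rewrite cB /incr /upd !a3 /= A !kE.
by rewrite iE D4 !a3 /= D3 A Q D dE cE !kE.
Qed.

Lemma insert_loop es (M : nat -> bool) N l s L :
  (forall v, av s aMark v = M v) -> linked (av s aNext) l (vv s rP) ->
  {in l, forall i, i < size es} ->
  (forall e, e \in es -> (esrc e < N) && (edst e < N)) ->
  list_inv N L s -> size l + size L < N ->
  exists t s', [/\ ev es (While rP insert_body) s t s',
    t <= size l * (cost insert_body).+1 + 1 &
    list_inv N (catrev [seq orient M (edge_nth es i) | i <- l] L) s'].
Proof.
elim: l s L => [|i l IH] s L mk /= lk ls bN inv sN.
  by exists 1, s; split=> //; exact: EvDone.
case: lk => pE lk; have im : i < size es by apply: ls; rewrite mem_head.
have /andP[e1 e2] := bN _ (mem_nth (0, 0, 0) im).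
have [p1 p2] : (orient M (edge_nth es i)).1 < N /\ (orient M (edge_nth es i)).2 < N.
  by rewrite /orient; case: ifP.
have sL : size L < N by lia.
have [sf [inv' pE']] := insert_step im pE mk inv sL p1 p2.
have [t1 le1 ev1] := ev_run sf.
have [||||t2 [s2 [ev2 le2 inv2]]] := IH _ (orient M (edge_nth es i) :: L) _ _ _ bN inv'.
- by move=> v; rewrite (ev_frame_a ev1).
- by rewrite pE' (ev_frame_a ev1).
- by move=> j jl; apply: ls; rewrite inE jl orbT.
- by rewrite /= addnS.
exists (t1 + t2).+1, s2; split=> //; first by apply: EvLoop ev1 ev2; rewrite pE.
by rewrite mulSn -addnA addSn ltnS leq_add.
Qed.

(** * Weight classes and the total running time *)

Definition levels_ok es (M : nat -> bool) k :=
  bip M es /\ forall w, k < w -> chain_list (lev M es w).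

(** All classes of weight above [k] are done. The insertion order differs from that of [es], so the
    inserted list is known only up to permutation. *)
Definition level_inv es (M : nat -> bool) N k s :=
  [/\ forall v, av s aMark v = M v,
      forall w, linked (av s aNext) (bucket es 0 w) (av s aHead w),
      exists2 L, perm_eq L (lev M es k.+1) & list_inv N L s &
      vv s rBad = 0 <-> levels_ok es M k].

Lemma lev_bucket es M w :
  perm_eq (catrev [seq orient M (edge_nth es i) | i <- bucket es 0 w] (lev M es w.+1))
          (lev M es w).
Proof.
rewrite catrevE /lev /bucket subn0.
have -> : [seq orient M (edge_nth es i) | i <- iota 0 (size es) & ewt (edge_nth es i) == w]
    = [seq orient M e | e <- es & ewt e == w].
  rewrite -[in RHS](mkseq_nth (0, 0, 0) es) /mkseq filter_map -map_comp.
  by [].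
apply: perm_trans (_ : perm_eq ([seq orient M e | e <- es & ewt e == w] ++
    [seq orient M e | e <- es & w < ewt e]) _).
  by rewrite perm_cat2r perm_rev.
rewrite -map_cat perm_map // perm_sym.
have /permPl := perm_filterC (fun e => ewt e == w) [seq e <- es | w <= ewt e].
rewrite -!filter_predI perm_sym => /perm_trans; apply.
apply/permP => a; congr (count a (_ ++ _)); apply: eq_filter => e /=.
  by case: eqP => // ->; rewrite leqnn.
by rewrite ltn_neqAle eq_sym.
Qed.

Lemma perm_chain_list L L' : perm_eq L L' -> chain_list L <-> chain_list L'.
Proof.
by move=> /perm_mem E; split=> H p q; [rewrite -!E|rewrite !E]; apply: H.
Qed.

Lemma sum_eq_succ m g : \sum_(k < m) (g == k.+1) = (0 < g <= m).
Proof.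
elim: m => [|m IH]; first by rewrite big_ord0; case: g.
by rewrite big_ord_recr /= IH {IH}; case: g => // g; rewrite !ltnS eqSS; case: ltngtP.
Qed.

(** Each edge lies in at most one bucket; this makes the nested loops linear altogether. *)
Lemma sum_bucket es m (K : nat) :
  \sum_(k < m) size (bucket es 0 k.+1) * K <= size es * K.
Proof.
rewrite -big_distrl leq_mul2r; apply/orP; right.
rewrite /bucket subn0 -[leqRHS](size_iota 0); elim: (iota _ _) => [|j l IH].
  by rewrite big1.
rewrite (eq_bigr (fun k : 'I_m => (ewt (edge_nth es j) == k.+1) +
    size [seq j <- l | ewt (edge_nth es j) == k.+1])); last first.
  by move=> k _ /=; case: eqP.
by rewrite big_split sum_eq_succ /= -[(size l).+1]add1n leq_add // leq_b1.
Qed.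

(** The 9 consists of one unit to fetch the list head, one for the failing list test and at most 7
    for the commands after the inner loop. *)
Lemma level_step es (M : nat -> bool) N k s : uniq (map (orient M) es) ->
  size es < N -> (forall e, e \in es -> (esrc e < N) && (edst e < N)) ->
  k < size es -> level_inv es M N k.+1 s -> vv s rW = k.+1 ->
  exists t s', [/\ ev es level_body s t s',
    t <= size (bucket es 0 k.+1) * (cost insert_body).+1 + 9,
    level_inv es M N k s' & vv s' rW = k].
Proof.
move=> uE sN bN km [mk lk [L pL invL] bE] sW.
pose s1 := run es (Op (OGet rP aHead rW)) s.
have s1P : vv s1 rP = av s aHead k.+1 by rewrite /s1 /= upd_eq sW.
set l := bucket es 0 k.+1.
set L' := catrev [seq orient M (edge_nth es i) | i <- l] L.
have pL' : perm_eq L' (lev M es k.+1).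
  apply: perm_trans (lev_bucket es M k.+1); rewrite /L' !catrevE.
  by rewrite perm_cat2l.
have sL' : size L' < N.
  rewrite (perm_size pL') size_map size_filter.
  exact: leq_ltn_trans (count_size _ _) sN.
have [|||t2 [s2 [ev2 le2 inv2]]] :=
    @insert_loop es M N l s1 L mk _ _ bN invL.
- by rewrite s1P; apply: lk.
- by move=> i; rewrite mem_filter mem_iota subn0 => /andP[_ /andP[_ ]].
- by move: sL'; rewrite /L' catrevE size_cat size_rev size_map.
pose tl := Seq (If rImb (set1 rBad) Skip) (Op (OPred rW rW)).
have sf : safe es tl s2 by rewrite /= if_same.
have [t3 le3 ev3] := ev_run sf; set s3 := run es tl s2 in ev3.
have s2W : vv s2 rW = k.+1 by rewrite (ev_frame_v ev2).
have imbE : vv s2 rImb = 0 <-> chain_list (lev M es k.+1).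
  rewrite inv2.2; apply: iff_trans (perm_chain_list pL'); apply: imbalanceP => //.
  - rewrite (perm_uniq pL'); apply: subseq_uniq uE.
    by apply: map_subseq; apply: filter_subseq.
  - move=> p; rewrite (perm_mem pL') => /mapP[e]; rewrite mem_filter => /andP[_ ees] ->.
    by have /andP[e1 e2] := bN _ ees; rewrite /orient; case: ifP; rewrite /= e1 e2.
have a3 : av s3 = av s2 by rewrite /s3 /=; case: ifP.
have i3 : vv s3 rImb = vv s2 rImb by rewrite /s3 /= /upd /=; case: ifP.
have w3 : vv s3 rW = k.
  by rewrite /s3 /=; case: ifP => _; rewrite /= /upd /= s2W.
have b3 : vv s3 rBad = if vv s2 rImb == 0 then vv s rBad else 1.
  rewrite /s3 /=; case: ifP => _; rewrite /= /upd //=.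
  by rewrite (ev_frame_v ev2).
exists (1 + (t2 + t3)), s3; split=> //.
- apply: EvSeq (EvOp _) _ => //; apply: EvSeq ev2 _.
  exact: ev3.
- have {}le3 : t3 <= 7 by apply: leq_trans le3 _.
  by move: (size l * _) le2 => Z; lia.
split.
- by move=> v; rewrite a3 (ev_frame_a ev2) //; apply: mk.
- by move=> w; rewrite a3 !(ev_frame_a ev2) //; apply: lk.
- by exists L' => //; rewrite /list_inv a3 i3.
(* A raised flag stays raised, and the new class adds precisely the condition at [w = k.+1]. *)
rewrite b3; split=> [|[B H]].
  case: eqP => // /imbE c /bE[B H]; split=> // w kw.
  by case: (ltngtP w k.+1) => [|/H //|-> //]; rewrite ltnS leqNgt kw.
case: eqP => [_|]; last by case; apply/imbE/H.
by apply/bE; split=> // w kw; apply: H; apply: ltnW.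
Qed.

Lemma edge_loop es body K (I : nat -> store -> Prop) s :
  (forall k s, k < size es -> I k.+1 s -> vv s rI = k.+1 ->
     safe es body s /\ let s' := run es body s in I k s' /\ vv s' rI = k) ->
  cost body <= K -> I (size es) (setv s rI (vv s rM)) -> vv s rM = size es ->
  exists t s', [/\ ev es (edge_pass body) s t s',
    t <= size es * K.+1 + 2 & I 0 s'].
Proof.
move=> H cK Is sM.
have [||| t [s' [e le I0]]] := @ev_for es rI body (fun=> K) I (size es) (setv s rI (vv s rM)).
- move=> k s0 km I0 s0i; have [sf [I1 s1i]] := H k s0 km I0 s0i.
  have [t1 le1 ev1] := ev_run sf.
  by exists t1, (run es body s0); split=> //; apply: leq_trans cK.
- by [].
- by rewrite /= upd_eq.
exists (1 + t), s'; split=> //; first by apply: EvSeq e; apply: EvOp.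
by move: le; rewrite sum_nat_const card_ord; lia.
Qed.

(** Surjectivity: the values from 1 to [maxw es] all occur in the list of weights. *)
Lemma maxw_size n es : valid_wgraph n es -> maxw es <= size es.
Proof.
case=> _ _ _ surj; rewrite -(size_map ewt) -[leqLHS](size_iota 1).
apply: uniq_leq_size (iota_uniq _ _) _ => j; rewrite mem_iota add1n ltnS => /surj.
by case/hasP=> e ees /eqP <-; apply: map_f.
Qed.

Lemma mainP n es : valid_wgraph n es ->
  exists t s', [/\ ev es main (store0 es) t s',
    t <= 150 * (size es).+1 & vv s' rOut = 1 <-> level_chain n es].
Proof.
move=> V; case: (V) => _ /allP bnd _ _; pose m := size es.
have loopl : all (fun e => esrc e != edst e) es.
  by apply/allP=> e /bnd/and4P[].
have [||||t1 [s1 [ev1 le1 [[d1 max1 hub1] lk1]]]] :=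
   @edge_loop es scan_body 30 (scan_inv es) (store0 es).
- by move=> k s km; apply: scan_step.
- by [].
- split; first by rewrite drop_size; split.
  by move=> w; rewrite /bucket subnn.
- by [].
set hub := vv s1 rHub in hub1; pose M := nbr es hub.
have hub_max v : mdeg es v <= mdeg es hub.
  by have := max1 v; rewrite hub1 drop0.
have [||||t2 [s2 [ev2 le2 [mk2 hub2]]]] :=
   @edge_loop es mark_body 30 (mark_inv es hub) s1.
- by move=> k s km; apply: mark_step.
- by [].
- split=> // v; rewrite drop_size /= (ev_frame_a ev1) //.
- by rewrite (ev_frame_v ev1).
have [||||t3 [s3 [ev3 le3 [mk3 bad3]]]] :=
   @edge_loop es side_body 30 (side_inv es M) s2.
- by move=> k s km; apply: side_step.
- by [].
- split=> [v|]; first by rewrite mk2 drop0.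
  by rewrite drop_size /= /upd /= (ev_frame_v ev2) // (ev_frame_v ev1).
- by rewrite (ev_frame_v ev2) // (ev_frame_v ev1).
(* [N] exceeds every vertex and every degree. It occurs only in the analysis, not in the program. *)
pose N := (n + m).+1; pose s4 := setv s3 rW (vv s3 rM).
have m3 : vv s3 rM = m by rewrite (ev_frame_v ev3) // (ev_frame_v ev2) // (ev_frame_v ev1).
have wm e : e \in es -> ewt e <= m by move=> /(ewt_maxw) h; apply: leq_trans h (maxw_size V).
(* The insertion phase thus starts from the empty graph, for which the untouched zero arrays are
   correct. *)
have lev0 w : m < w -> lev M es w = [::].
  move=> mw; rewrite /lev; have -> : [seq e <- es | w <= ewt e] = [::] => //.
  rewrite (eq_in_filter (_ : {in es, _ =1 pred0})) ?filter_pred0 // => e /wm em.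
  by apply/negbTE; rewrite -ltnNge (leq_ltn_trans em).
have fr a : a \notin [:: aHead; aNext; aDeg; aMark] -> av s4 a = (fun=> 0).
  rewrite !inE => h; rewrite /s4 /= (ev_frame_a ev3) // (ev_frame_a ev2) ?(ev_frame_a ev1) //.
    by rewrite /= !inE; move: h; do 4 case: eqP.
  by rewrite /= !inE; move: h; do 4 case: eqP.
have I4 : level_inv es M N m s4.
  split.
  - by move=> v; rewrite mk3.
  - by move=> w; rewrite /s4 /= !(ev_frame_a ev3) // !(ev_frame_a ev2) //; apply: lk1.
  - have c0 : conj N (fun=> 0) =1 (fun=> 0) by move=> j; rewrite conj_out.
    exists [::]; first by rewrite lev0.
    split; first by split=> j; rewrite fr // ?(eq_conj N c0) c0.
    rewrite /s4 /= /upd /= (ev_frame_v ev3) // (ev_frame_v ev2) // (ev_frame_v ev1) //.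
    apply/esym/eqP/dist_eq0 => j _.
    by rewrite c0 (eq_conj N c0) c0.
  rewrite /s4 /= /upd /=; split=> [/eqP|[+ _]].
    by rewrite bad3 drop0 => B; split=> // w /lev0->.
  by move: bad3; rewrite drop0 => <- /eqP.
have uE : uniq (map (orient M) es) by apply: (uniq_orient V) (subseq_refl _).
have bN e : e \in es -> (esrc e < N) && (edst e < N).
  move=> /bnd/and4P[h1 h2 _ _]; rewrite /N !ltnS.
  by rewrite !(leq_trans (ltnW _) (leq_addr m n)).
have [||| t4 [s5 [ev4 le4 I5]]] := @ev_for es rW level_body
   (fun k => size (bucket es 0 k.+1) * (cost insert_body).+1 + 9) (level_inv es M N) m s4.
- by move=> k s km; apply: level_step => //; rewrite /N ltnS leq_addl.
- exact: I4.
- by rewrite /s4 /= upd_eq.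
have {}le4 : t4 <= m * 50 + 1.
  apply: leq_trans le4 _; rewrite leq_add2r.
  rewrite (eq_bigr (fun k : 'I_m => size (bucket es 0 k.+1) * (cost insert_body).+1 + 10)); last first.
    by move=> k _; rewrite -addnS.
  rewrite big_split /= sum_nat_const card_ord.
  apply: leq_trans (leq_add (sum_bucket es m _) (leqnn _)) _.
  by rewrite -mulnDr leq_mul2l orbC.
have sf : safe es answer s5 by rewrite /= if_same.
have [t5 le5 ev5] := ev_run sf.
exists (t1 + (t2 + (t3 + ((1 + t4) + t5)))), (run es answer s5); split.
- apply: EvSeq ev1 _; apply: EvSeq ev2 _; apply: EvSeq ev3 _.
  by apply: EvSeq ev5; apply: EvSeq ev4; apply: EvOp.
- have {}le5 : t5 <= 5 by apply: leq_trans le5 _.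
  by rewrite -/m in le1 le2 le3 *; lia.
have [_ _ _ bad5] := I5.
have -> : vv (run es answer s5) rOut = if vv s5 rBad == 0 then 1 else 0.
  by rewrite /= /upd /=; case: ifP.
apply: (iff_trans _ (iff_sym (level_chainP V hub_max))).
apply: (iff_trans _ bad5).
by case: eqP; split.
Qed.

(* There is a word-RAM program P and a constant c such that on every weighted
   graph (G = (V,E), omega) with |V| = n, |E| = size es, P halts within
   c * (|V| + |E| + 1) steps (using only values of size O(|V|+|E|)), with
   output register R[0] = 1 iff (G, omega) is level-chain. *)
Theorem theorem4p12 :
  exists (P : program) (c : nat),
    forall (n : nat) (es : seq wedge),
      valid_wgraph n es ->
      exists t : nat,
        let s := exec P t (init_state (encode n es)) in
        [/\ t <= c * (n + size es + 1),
            halted P s,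
            peak s <= c * (n + size es + 1) &
            (regs s 0 = 1 <-> level_chain n es)].
Proof.
(* The peak dictates the constant: 16 times the running time bound [150 * (size es).+1] is 2400 per
   unit, and the rest covers [base es] and the input values. *)
exists (full_prog main), 2500 => n es V.
have [t [s' [e le out]]] := mainP V.
have [|t' [le' h pk r0]] := @full_progP n es main t s' _ e.
  have ms := maxw_size V; case: (V) => _ /allP bnd _ _; apply/allP=> x xs.
  have /and4P[h1 h2 _ _] := bnd _ xs; have := ewt_maxw xs; lia.
exists t'; split=> //; last by rewrite r0.
  by lia.
by apply: leq_trans pk _; rewrite /base; lia.
Qed.
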